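(* If a random variable $X$ has a moment-generating function (i.e. $\mathbb{E}[e^{sX}]<\infty$ for all $s$ in some open interval around $0$), then $$\lim_{n\to\infty}\sup_{t\ge0}\big(\mathrm{pmmse}_n(X,t)-\mathrm{mmse}(X,t)\big)=0.$$
   Context: $N\sim\mathcal{N}(0,1)$ independent of $X$, $Y_t=\sqrt{t}X+N$. $\mathrm{pmmse}_n(X,t):=\min_{\boldsymbol{c}\in\mathbb{R}^{n+1}}\mathbb{E}[(X-\boldsymbol{c}^T(1,Y_t,\dots,Y_t^n)^T)^2]$ and $\mathrm{mmse}(X,t):=\mathbb{E}[(X-\mathbb{E}[X\mid Y_t])^2]$. *)

(* Defs.v *)
From HB Require Import structures.
From mathcomp Require Import all_boot all_order all_algebra.
From mathcomp Require Import all_classical all_reals all_analysis.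
Set Implicit Arguments. Unset Strict Implicit. Unset Printing Implicit Defensive.
Import Order.TTheory GRing.Theory Num.Theory.
Import numFieldNormedType.Exports.
Local Open Scope classical_set_scope.
Local Open Scope ring_scope.

Section defs.
Context {d : measure_display} {T : measurableType d} {R : realType}.
Variable P : probability T R.

Definition independent_RV (X Y : T -> R) : Prop :=
  forall A B : set R, measurable A -> measurable B ->
    P (X @^-1` A `&` Y @^-1` B) = (P (X @^-1` A) * P (Y @^-1` B))%E.

Definition std_normal (N : {RV P >-> R}) : Prop :=
  forall A : set R, measurable A -> distribution P N A = normal_prob 0 1 A.

Definition has_mgf (X : T -> R) : Prop :=
  exists a : R, 0 < a /\ forall s : R, -a < s < a -> ('M_P X s < +oo)%E.

Definition Yt (X N : T -> R) (t : R) : T -> R :=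
  fun w => Num.sqrt t * X w + N w.

(* g \o Y is a version of the conditional expectation E[X | Y]:
   g Borel measurable, g(Y) integrable, and E[X 1_{Y in B}] = E[g(Y) 1_{Y in B}]
   for every Borel set B (Doob-Dynkin: every sigma(Y)-measurable r.v. is g(Y)). *)
Definition is_cond_exp (X Y : T -> R) (g : R -> R) : Prop :=
  [/\ measurable_fun setT g,
      P.-integrable setT (fun w => (g (Y w))%:E) &
      forall B : set R, measurable B ->
        ('E_P[fun w => (X w * \1_(Y @^-1` B) w)%R] =
        'E_P[fun w => (g (Y w) * \1_(Y @^-1` B) w)%R])%E ].

(* mmse = E[(X - E[X|Y])^2], with E[X|Y] = g(Y) *)
Definition mmse (X Y : T -> R) (g : R -> R) : \bar R :=
  ('E_P[fun w => ((X w - g (Y w)) ^+ 2)%R])%E.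

Definition pmmse (n : nat) (X Y : T -> R) : \bar R :=
  ereal_inf [set ('E_P[fun w => ((X w - p.[Y w]) ^+ 2)%R])%E |
             p in [set p : {poly R} | (size p <= n.+1)%N]].
End defs.

(* Main.v *)
Require Import Defs.
From HB Require Import structures.
From mathcomp Require Import all_boot all_order all_algebra.
From mathcomp Require Import all_classical all_reals all_analysis.
From mathcomp Require Import measurable_realfun ring lra.
Import Order.TTheory GRing.Theory Num.Theory.
Import numFieldNormedType.Exports.
Local Open Scope classical_set_scope.
Local Open Scope ring_scope.

(** Write Y = a X + N with a = sqrt t.  Only lower semicontinuity in a of the
    minimal mean square error m(a) is needed, not the regularity of
    t |-> E[X | Y_t]: with the Gaussian density phi, m(a) is the Lebesgue integral
    over y of A2 - A1^2 / A0, where Ak = E[X^k phi (y - a X)], the integrand is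
    nonnegative and continuous in a, and Fatou's lemma applies.

    If the error gap stayed above e along n -> oo, at points a_n, the a_n would be
    bounded because the affine estimator Y / a has error E[N^2] / a^2, hence would
    accumulate at some a.  A polynomial p that is e/2-optimal for a exists because
    polynomials are dense in L^2(Y); by dominated convergence its error at a_n
    tends to its error at a, which contradicts the semicontinuity of m.

    Density of the polynomials: call a bounded u a multiplier if u q is an L^2
    limit of polynomials for every polynomial q.  By Taylor expansion and the
    exponential moments of Y, x |-> sin (r x) is a multiplier for small r.
    Multipliers form an algebra stable under bounded pointwise limits and under
    the exponential, and exp (- exp (n - n^2 v)) tends to the indicator of v > 0,
    which leads to rays, Borel sets and finally to all of L^2.

    That the supremum is nonnegative is seen at t = 0, where Y = N is independent
    of X and the conditional expectation is the constant E[X]. *)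

(** * Growth of polynomials and integrals of squares *)

Lemma measurable_horner (R : realType) (p : {poly R}) :
  measurable_fun [set: R] (fun x => p.[x]).
Proof.
elim/poly_ind: p => [|p c IH].
  by under eq_fun do rewrite horner0; exact: measurable_cst.
under eq_fun do rewrite hornerMXaddC.
by apply: measurable_funD => //; exact: measurable_funM.
Qed.

(** Induction on the polynomial with the rate halved at each step: the new factor x is absorbed by
    |x| <= (2 / r) exp (r |x| / 2). *)
Lemma horner_le_expR (R : realType) (r : R) (p : {poly R}) : 0 < r ->
  exists2 C, 0 <= C & forall x, `|p.[x]| <= C * expR (r * `|x|).
Proof.
elim/poly_ind: p r => [|p c IH] r r0.
  by exists 0 => // x; rewrite horner0 normr0 mul0r.
have r20 : 0 < r / 2 by lra.
have [C C0 HC] := IH _ r20.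
exists (C * (2 / r) + `|c|) => [|x].
  by rewrite addr_ge0// mulr_ge0// divr_ge0// ltW.
rewrite hornerMXaddC (le_trans (ler_normD _ _))// mulrDl lerD//; last first.
  by rewrite ler_peMr// -expR0 ler_expR mulr_ge0// ltW.
have -> : r * `|x| = r / 2 * `|x| + r / 2 * `|x| by lra.
rewrite normrM expRD mulrACA ler_pM//.
rewrite mulrAC ler_pdivlMr//.
have := expR_ge1Dx (r / 2 * `|x|); lra.
Qed.

Lemma sqr_ge0E (R : realType) (x : R) : (0 <= (x ^+ 2)%:E)%E.
Proof. by rewrite lee_fin sqr_ge0. Qed.
#[local] Hint Resolve sqr_ge0E : core.

Section sq_integral.
Context {d} {T : measurableType d} {R : realType} (P : probability T R).

Lemma le_integral_EFin (f g : T -> R) :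
  measurable_fun setT f -> measurable_fun setT g ->
  (forall w, 0 <= f w) -> (forall w, f w <= g w) ->
  (\int[P]_w (f w)%:E <= \int[P]_w (g w)%:E)%E.
Proof.
move=> mf mg f0 fg; apply: ge0_le_integral => //.
- by move=> w _; rewrite lee_fin.
- exact/measurable_EFinP.
- exact/measurable_EFinP.
- by move=> w _; rewrite lee_fin.
Qed.

(** Young's inequality: the pointwise slack is (eta f - g)^2 / eta. The free [eta] allows a constant
    close to 1 in front of the first term, as [polynomial_near_bayes] requires. *)
Lemma integral_sqrD_le (f g : T -> R) (eta : R) : 0 < eta ->
  measurable_fun setT f -> measurable_fun setT g ->
  (\int[P]_w ((f w + g w) ^+ 2)%:E <=
   (1 + eta)%:E * \int[P]_w ((f w) ^+ 2)%:E +
   (1 + eta^-1)%:E * \int[P]_w ((g w) ^+ 2)%:E)%E.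
Proof.
move=> e0 mf mg.
have e1 : 0 < 1 + eta by lra.
have e2 : 0 < 1 + eta^-1 by rewrite addr_gt0 ?invr_gt0.
have m2 (h : T -> R) : measurable_fun setT h ->
    measurable_fun setT (fun w => ((h w) ^+ 2)%:E).
  by move=> mh; apply/measurable_EFinP; exact: measurable_funX.
rewrite -!ge0_integralZl ?lee_fin//; try exact: ltW; try exact: m2.
rewrite -ge0_integralD//; first last.
- by apply: measurable_funeM; exact: m2.
- by move=> w _; rewrite mule_ge0 ?lee_fin ?sqr_ge0// ltW.
- by apply: measurable_funeM; exact: m2.
- by move=> w _; rewrite mule_ge0 ?lee_fin ?sqr_ge0// ltW.
under [leRHS]eq_integral do rewrite -!EFinM -EFinD.
apply: le_integral_EFin => [|||w].
- by apply: measurable_funX; exact: measurable_funD.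
- by apply: measurable_funD; apply: measurable_funM => //; exact: measurable_funX.
- by move=> w; rewrite sqr_ge0.
rewrite -subr_ge0.
suff -> : (1 + eta) * f w ^+ 2 + (1 + eta^-1) * g w ^+ 2 - (f w + g w) ^+ 2
  = (eta * f w - g w) ^+ 2 / eta by rewrite divr_ge0 ?sqr_ge0// ltW.
by field; rewrite gt_eqF.
Qed.

Lemma cvg_integral_sqr0 (h : (T -> R)^nat) (G : T -> R) :
  (forall n, measurable_fun setT (h n)) -> measurable_fun setT G ->
  (forall n w, `|h n w| <= G w) -> (\int[P]_w ((G w) ^+ 2)%:E < +oo)%E ->
  (forall w, h ^~ w @ \oo --> 0) ->
  (\int[P]_w ((h n w) ^+ 2)%:E @[n --> \oo] --> 0)%E.
Proof.
move=> mh mG hG iG h0.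
rewrite -[X in _ --> X](integral0 P setT).
apply: (@dominated_cvg _ _ _ P setT measurableT _ (cst 0%E)
  (fun w => ((G w) ^+ 2)%:E)) => //.
- by move=> n; apply/measurable_EFinP; exact: measurable_funX.
- move=> w _; apply: cvg_EFin; first exact: nearW.
  by rewrite -(mulr0 0); apply: cvgM; exact: h0.
- apply/integrableP; split; first by apply/measurable_EFinP; exact: measurable_funX.
  by under eq_integral do rewrite gee0_abs//.
- move=> n w _; rewrite gee0_abs// lee_fin -[leLHS]real_normK ?num_real//.
  by rewrite lerXn2r// ?nnegrE// (le_trans _ (hG n w)).
Qed.

Lemma measurable_expR_norm (X : T -> R) (r : R) :
  measurable_fun setT X ->
  measurable_fun setT (fun w => expR (r * `|X w|)).
Proof.
move=> mX; apply: measurableT_comp => //; apply: measurable_funM => //.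
exact: measurableT_comp.
Qed.

End sq_integral.

(** * Bounds on Taylor sums and a smooth approximation of the step function *)

Lemma series_exp_coeff_le (R : realType) (x : R) n : 0 <= x ->
  series (exp_coeff x) n <= expR x.
Proof.
move=> x0; apply: nondecreasing_cvgn_le; last exact: is_cvg_series_exp_coeff.
by apply: nondecreasing_series => k _ _; exact: exp_coeff_ge0.
Qed.

Lemma norm_series_sin_coeff_le (R : realType) (x : R) n :
  `|series (sin_coeff x) n| <= expR `|x|.
Proof.
apply: (le_trans _ (series_exp_coeff_le _ _ n (normr_ge0 x))).
apply: (le_trans (ler_norm_sum _ _ _)); apply: ler_sum => k _.
rewrite /sin_coeff /exp_coeff/= !normrM !normrX normrN1 expr1n mulr1.
rewrite normfV !normr_nat ler_wpM2r ?invr_ge0//.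
by case: (odd k); rewrite ?mul1r ?mul0r ?exprn_ge0.
Qed.

Lemma cvg_series_sin_coeff (R : realType) (x : R) :
  series (sin_coeff x) @ \oo --> sin x.
Proof. by rewrite sin.unlock; exact: is_cvg_series_sin_coeff. Qed.

(** For v > 0 the inner exponent is at most - n as soon as n >= 2 / v; for v <= 0 it is at least n.
    The linear term is what sends the case v = 0 to the limit 0. *)
Lemma expR_opp_expR_cvg (R : realType) (v : R) :
  expR (- expR (n%:R - n%:R ^+ 2 * v)) @[n --> \oo] --> ((0 < v)%R%:R : R).
Proof.
have [v0|v0] := ltP 0 v.
  apply: (@squeeze_cvgr _ _ _ _ (fun n : nat => 1 - expR (- n%:R)) (cst 1)).
  - near=> n; rewrite expR_le1 oppr_le0 expR_ge0 andbT.
    apply: (le_trans _ (expR_ge1Dx _)); rewrite lerD2l lerN2 ler_expR.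
    have : 2 / v <= n%:R by near: n; exact: nbhs_infty_ger.
    rewrite ler_pdivrMr// => /(ler_wpM2l (ler0n R n)); lra.
  - rewrite -[X in _ --> X]subr0; apply: cvgB; first exact: cvg_cst.
    exact: cvgn_expR.
  - exact: cvg_cst.
apply: (@squeeze_cvgr _ _ _ _ (cst 0) (fun n : nat => expR (- n%:R))).
- near=> n; rewrite expR_ge0/= ler_expR lerN2.
  apply: (@le_trans _ _ (1 + n%:R)); first by rewrite lerDr.
  apply: le_trans (expR_ge1Dx _) _; rewrite ler_expR.
  by rewrite lerDl oppr_ge0 mulr_ge0_le0// sqr_ge0.
- exact: cvg_cst.
- exact: cvgn_expR.
Unshelve. all: by end_near. Qed.

(** * Density of the polynomials in L^2 *)

Section polynomial_density.
Context {d} {T : measurableType d} {R : realType} (P : probability T R).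
Variables (Y : T -> R) (s : R).
Implicit Types (f g u v : R -> R) (e c K r : R).
Hypothesis mY : measurable_fun setT Y.
Hypothesis s0 : 0 < s.
Hypothesis expY : (\int[P]_w (expR (s * `|Y w|))%:E < +oo)%E.

Local Lemma measurable_compY (f : R -> R) : measurable_fun setT f ->
  measurable_fun setT (fun w => f (Y w)).
Proof. by move=> mf; exact: (measurableT_comp mf mY). Qed.

Definition poly_approx (f : R -> R) := forall e, 0 < e ->
  exists p : {poly R}, (\int[P]_w ((f (Y w) - p.[Y w]) ^+ 2)%:E <= e%:E)%E.

(** Approximability is asked of [u x * q.[x]] for every [q], and not of [u] alone, so that products
    of multipliers are again multipliers. *)
Definition multiplier (u : R -> R) := [/\ measurable_fun setT u,
  exists K, forall x, `|u x| <= K &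
  forall q : {poly R}, poly_approx (fun x => u x * q.[x])].

(** The triangle inequality for squared distances costs a factor 2 ([eta = 1] in
    [integral_sqrD_le]), hence the tolerances [e / 4] below. *)
Local Lemma sqr_dist_trans f g (h : R -> R) e (a b : R) :
  measurable_fun setT f -> measurable_fun setT g -> measurable_fun setT h ->
  (\int[P]_w ((f (Y w) - g (Y w)) ^+ 2)%:E <= a%:E)%E ->
  (\int[P]_w ((g (Y w) - h (Y w)) ^+ 2)%:E <= b%:E)%E ->
  2 * a + 2 * b <= e ->
  (\int[P]_w ((f (Y w) - h (Y w)) ^+ 2)%:E <= e%:E)%E.
Proof.
move=> mf mg mh fg gh abe.
have m1 : measurable_fun setT (fun w => f (Y w) - g (Y w)).
  by apply: (measurable_compY (fun x => f x - g x)); exact: measurable_funB.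
have m2 : measurable_fun setT (fun w => g (Y w) - h (Y w)).
  by apply: (measurable_compY (fun x => g x - h x)); exact: measurable_funB.
have := integral_sqrD_le P _ _ _ ltr01 m1 m2.
under eq_integral do rewrite subrKA.
move/le_trans; apply; rewrite invr1 -[1 + 1]/(2 : R).
apply: (@le_trans _ _ (2%:E * a%:E + 2%:E * b%:E)%E).
  by apply: leeD; apply: lee_wpmul2l.
by rewrite -!EFinM -EFinD lee_fin.
Qed.

Lemma poly_approx_closed f : measurable_fun setT f ->
  (forall e, 0 < e -> exists g, [/\ measurable_fun setT g, poly_approx g &
     (\int[P]_w ((f (Y w) - g (Y w)) ^+ 2)%:E <= e%:E)%E]) ->
  poly_approx f.
Proof.
move=> mf H e e0; have e40 : 0 < e / 4 by lra.
have [g [mg /(_ _ e40)[p gp] fg]] := H _ e40.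
exists p; apply: (sqr_dist_trans _ g (fun x => p.[x]) _ _ _ mf mg _ fg gp); last lra.
exact: measurable_horner.
Qed.

Lemma poly_approx_cvg (f_ : (R -> R)^nat) f (G : R -> R) :
  (forall n, measurable_fun setT (f_ n)) -> measurable_fun setT f ->
  measurable_fun setT G ->
  (forall n, poly_approx (f_ n)) ->
  (forall n x, `|f x - f_ n x| <= G x) ->
  (\int[P]_w ((G (Y w)) ^+ 2)%:E < +oo)%E ->
  (forall x, f_ ^~ x @ \oo --> f x) -> poly_approx f.
Proof.
move=> mf_ mf mG af fG iG f_f; apply: poly_approx_closed => // e e0.
have := cvg_integral_sqr0 P (fun n w => f (Y w) - f_ n (Y w)) (G \o Y).
have m1 n : measurable_fun setT (fun w => f (Y w) - f_ n (Y w)).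
  by apply: (measurable_compY (fun x => f x - f_ n x)); exact: measurable_funB.
move=> /(_ m1 (measurable_compY _ mG) (fun n w => fG n (Y w)) iG).
have f0 w : (fun n => f (Y w) - f_ n (Y w)) @ \oo --> 0.
  by rewrite -[X in _ --> X](subrr (f (Y w))); apply: cvgB;
    [exact: cvg_cst|exact: f_f].
move=> /(_ f0) /fine_cvgP[fin] /cvgrPdist_le /(_ _ e0) cv.
near \oo => n.
exists (f_ n); split => //.
rewrite -[leLHS]fineK; last by near: n.
rewrite lee_fin.
have : `|0 - fine (\int[P]_w ((f (Y w) - f_ n (Y w)) ^+ 2)%:E)| <= e by near: n.
rewrite sub0r normrN; apply: le_trans; exact: ler_norm.
Unshelve. all: by end_near. Qed.

Lemma poly_approxD f g : measurable_fun setT f -> measurable_fun setT g ->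
  poly_approx f -> poly_approx g -> poly_approx (fun x => f x + g x).
Proof.
move=> mf mg af ag e e0; have e40 : 0 < e / 4 by lra.
have [p fp] := af _ e40; have [q gq] := ag _ e40; exists (p + q).
have mp := measurable_horner _ p; have mq := measurable_horner _ q.
apply: (sqr_dist_trans (fun x => f x + g x) (fun x => p.[x] + g x)
  (fun x => (p + q).[x]) e (e / 4) (e / 4)).
- exact: measurable_funD.
- exact: measurable_funD.
- exact: measurable_horner.
- by under eq_integral do rewrite /= opprD addrACA subrr addr0.
- under eq_integral do rewrite /= hornerD opprD addrACA subrr add0r.
  exact: gq.
- lra.
Qed.

Lemma poly_approx_poly (q : {poly R}) : poly_approx (fun x => q.[x]).
Proof.
move=> e e0; exists q; under eq_integral do rewrite subrr expr0n.
by rewrite integral0 lee_fin ltW.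
Qed.

(** Multiplication by the bounded [u] is continuous in L^2, so an approximation p of f yields the
    approximation u p of u f, and u p is approximable by definition of a multiplier. *)
Lemma poly_approx_mult u f : multiplier u -> measurable_fun setT f ->
  poly_approx f -> poly_approx (fun x => u x * f x).
Proof.
move=> [mu [K uK] au] mf af; apply: poly_approx_closed => [|e e0].
  exact: measurable_funM.
(* The [+ 1] keeps the divisor positive when K = 0. *)
have K1 : 0 < K ^+ 2 + 1 by rewrite ltr_wpDl ?sqr_ge0.
have [p fp] := af _ (divr_gt0 e0 K1).
have mp := measurable_horner _ p.
exists (fun x => u x * p.[x]); split; [exact: measurable_funM|exact: au|].
apply: (@le_trans _ _
    ((K ^+ 2 + 1)%:E * \int[P]_w ((f (Y w) - p.[Y w]) ^+ 2)%:E)%E); last first.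
  rewrite muleC -lee_pdivlMr//.
rewrite -ge0_integralZl//; first last.
- by rewrite lee_fin ltW.
- apply/measurable_EFinP; apply: (measurable_compY (fun x => (f x - p.[x]) ^+ 2)).
  by apply: measurable_funX; exact: measurable_funB.
under [leRHS]eq_integral do rewrite -EFinM.
apply: le_integral_EFin => [|||w].
- apply: (measurable_compY (fun x => (u x * f x - u x * p.[x]) ^+ 2)).
  by apply: measurable_funX; apply: measurable_funB; exact: measurable_funM.
- apply: (measurable_compY (fun x => (K ^+ 2 + 1) * (f x - p.[x]) ^+ 2)).
  by apply: measurable_funM => //; apply: measurable_funX; exact: measurable_funB.
- by move=> w; rewrite sqr_ge0.
- rewrite -mulrBr exprMn ler_wpM2r ?sqr_ge0// ler_wpDr//.
  rewrite -[leLHS]real_normK ?num_real// lerXn2r// nnegrE.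
  exact: le_trans (uK 0).
Qed.

Lemma multiplier_cst c : multiplier (cst c).
Proof.
split; first exact: measurable_cst.
  by exists `|c|.
move=> q e e0; have [p hp] := poly_approx_poly (c *: q) _ e0; exists p.
by move: hp; under eq_integral do rewrite hornerZ.
Qed.

Lemma multiplierM u v : multiplier u -> multiplier v ->
  multiplier (fun x => u x * v x).
Proof.
move=> mu mv; have [mfu [K uK] _] := mu; have [mfv [L vL] av] := mv; split.
- exact: measurable_funM.
- by exists (K * L) => x; rewrite normrM ler_pM.
- move=> q; under eq_fun do rewrite -mulrA.
  apply: (poly_approx_mult u (fun x => v x * q.[x])) => //.
  by apply: measurable_funM => //; exact: measurable_horner.
Qed.

Lemma multiplierD u v : multiplier u -> multiplier v ->
  multiplier (fun x => u x + v x).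
Proof.
move=> [mu [K uK] au] [mv [L vL] av]; split.
- exact: measurable_funD.
- by exists (K + L) => x; rewrite (le_trans (ler_normD _ _))// lerD.
- move=> q; under eq_fun do rewrite mulrDl.
  have mq := measurable_horner _ q.
  apply: (poly_approxD (fun x => u x * q.[x]) (fun x => v x * q.[x])).
  + exact: measurable_funM.
  + exact: measurable_funM.
  + exact: au.
  + exact: av.
Qed.

Lemma multiplierZ c u : multiplier u -> multiplier (fun x => c * u x).
Proof. by apply: multiplierM; exact: multiplier_cst. Qed.

Lemma multiplierB u v : multiplier u -> multiplier v ->
  multiplier (fun x => u x - v x).
Proof.
move=> mu /(multiplierZ (-1)) mv; under eq_fun do rewrite -mulN1r.
exact: multiplierD.
Qed.

Lemma multiplier_sum I (l : seq I) (u_ : I -> R -> R) :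
  (forall i, multiplier (u_ i)) -> multiplier (fun x => \sum_(i <- l) u_ i x).
Proof.
move=> mu; elim: l => [|i l IH].
  by under eq_fun do rewrite big_nil; exact: multiplier_cst.
by under eq_fun do rewrite big_cons; exact: multiplierD.
Qed.

Lemma multiplierX u n : multiplier u -> multiplier (fun x => u x ^+ n).
Proof.
move=> mu; elim: n => [|n IH].
  by under eq_fun do rewrite expr0; exact: multiplier_cst.
by under eq_fun do rewrite exprS; exact: multiplierM.
Qed.

(** Budget of exponents: the polynomial costs a rate s / 4, the exponential factor a rate r <= s /
    4, and squaring doubles their sum, which gives at most s. *)
Lemma integral_sqr_poly_exp_lty (q : {poly R}) K r : 0 <= K -> 4 * r <= s ->
  0 <= r -> (\int[P]_w ((K * expR (r * `|Y w|) * `|q.[Y w]|) ^+ 2)%:E < +oo)%E.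
Proof.
move=> K0 rs r0; have s4 : 0 < s / 4 by rewrite divr_gt0.
have [C C0 HC] := horner_le_expR _ _ q s4.
apply: (@le_lt_trans _ _
  (\int[P]_w (((K * C) ^+ 2) * expR (s * `|Y w|))%:E)%E).
  apply: le_integral_EFin => [|||w].
  - apply: (measurable_compY (fun x => (K * expR (r * `|x|) * `|q.[x]|) ^+ 2)).
    apply: measurable_funX; apply: measurable_funM.
      apply: measurable_funM => //; apply: measurableT_comp => //.
      by apply: measurable_funM => //; exact: measurableT_comp.
    by apply: measurableT_comp => //; exact: measurable_horner.
  - by apply: measurable_funM => //; exact: measurable_expR_norm.
  - by move=> w; rewrite sqr_ge0.
  - have -> : s * `|Y w| = (s / 2 * `|Y w|) *+ 2 by rewrite mulr2n -mulrDl -splitr.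
    rewrite -mulr_natl expRM_natl -exprMn lerXn2r ?nnegrE ?mulr_ge0 ?expR_ge0//.
    rewrite -mulrA -[leRHS]mulrA ler_wpM2l//.
    apply: (@le_trans _ _ (expR (r * `|Y w|) * (C * expR (s / 4 * `|Y w|)))).
      by rewrite ler_wpM2l ?expR_ge0.
    rewrite mulrCA ler_wpM2l// -expRD ler_expR -mulrDl ler_wpM2r//; lra.
under eq_integral do rewrite EFinM.
rewrite ge0_integralZl//; first last.
- by apply/measurable_EFinP; exact: measurable_expR_norm.
- by rewrite lte_mul_pinfty// lee_fin sqr_ge0.
Qed.

(** Dominated convergence, with dominating function 2 K |q|. *)
Lemma multiplier_cvg (u_ : (R -> R)^nat) u K : (forall n, multiplier (u_ n)) ->
  (forall n x, `|u_ n x| <= K) -> (forall x, u_ ^~ x @ \oo --> u x) ->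
  multiplier u.
Proof.
move=> mu uK uu.
have mfu n : measurable_fun setT (u_ n) by have [] := mu n.
have mfu0 : measurable_fun setT u.
  exact: (measurable_fun_cvg mfu (fun x _ => uu x)).
have K0 : 0 <= K by exact: le_trans (uK 0%N 0).
have bu x : `|u x| <= K.
  have nu : `|u_ n x| @[n --> \oo] --> `|u x| by apply: cvg_norm; exact: uu.
  by apply: (cvgr_to_le nu); apply: nearW => n; exact: uK.
split => //; first by exists K.
move=> q; have mq := measurable_horner _ q.
(* The factor [expR (0 * _)] equals 1; it gives the bound the shape of [integral_sqr_poly_exp_lty]
   at rate 0. *)
apply: (poly_approx_cvg (fun n x => u_ n x * q.[x]) _
  (fun x => (2 * K) * expR (0 * `|x|) * `|q.[x]|)).
- by move=> n; exact: measurable_funM.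
- exact: measurable_funM.
- apply: measurable_funM; last exact: measurableT_comp.
  by under eq_fun do rewrite mul0r expR0; exact: measurable_cst.
- by move=> n; have [_ _] := mu n; apply.
- move=> n x; rewrite mul0r expR0 mulr1 -mulrBl normrM ler_wpM2r//.
  by rewrite (le_trans (ler_normB _ _))// mulr_natl mulr2n lerD.
- by apply: integral_sqr_poly_exp_lty; rewrite ?mulr_ge0 ?mulr0 ?(ltW s0).
- by move=> x; apply: cvgMr_tmp; exact: uu.
Qed.


(** The Taylor sums of sin (r x) times q are polynomials, and their distance to the limit is at most
    2 exp (r |x|) |q|, which is square integrable because 4 r <= s. *)
Lemma multiplier_sin r : 0 < r -> 4 * r <= s -> multiplier (fun x => sin (r * x)).
Proof.
move=> r0 rs.
have msin : measurable_fun setT (fun x => sin (r * x)).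
  apply: measurableT_comp => //.
  by apply: continuous_measurable_fun; exact: continuous_sin.
split => //; first by exists 1 => x; exact: sin_max.
move=> q; have mq := measurable_horner _ q.
have [S SE] : exists S : {poly R}^nat,
    forall n x, (S n).[x] = series (sin_coeff (r * x)) n.
  exists (fun n => \sum_(0 <= k < n)
    (((odd k)%:R * (-1) ^+ k.-1./2 * r ^+ k / k`!%:R) *: 'X^k)) => n x.
  rewrite horner_sum; apply: eq_bigr => k _.
  by rewrite hornerZ hornerXn /sin_coeff/= exprMn; ring.
apply: (poly_approx_cvg (fun n x => (S n).[x] * q.[x]) _
  (fun x => 2 * expR (r * `|x|) * `|q.[x]|)).
- by move=> n; apply: measurable_funM => //; exact: measurable_horner.
- exact: measurable_funM.
- apply: measurable_funM; last exact: measurableT_comp.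
  apply: measurable_funM => //; apply: measurableT_comp => //.
  by apply: measurable_funM => //; exact: measurableT_comp.
- by move=> n; have := poly_approx_poly (S n * q); under eq_fun do rewrite hornerM.
- move=> n x; rewrite -mulrBl normrM ler_wpM2r// (le_trans (ler_normB _ _))//.
  have rx0 : 0 <= r * `|x| by rewrite mulr_ge0// ltW.
  rewrite mulr_natl mulr2n lerD//.
    by rewrite (le_trans (sin_max _))// -expR0 ler_expR.
  rewrite SE (le_trans (norm_series_sin_coeff_le _ _ _))//.
  by rewrite normrM (gtr0_norm r0).
- by apply: integral_sqr_poly_exp_lty => //; exact: ltW.
- move=> x; apply: cvgMr_tmp; under eq_fun do rewrite SE.
  exact: cvg_series_sin_coeff.
Qed.

(** The partial sums of the exponential series at u are polynomials in u, bounded by exp K uniformly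
    in n. *)
Lemma multiplier_expR u : multiplier u -> multiplier (fun x => expR (u x)).
Proof.
move=> mu; have [_ [K uK] _] := mu.
apply: (multiplier_cvg (fun n x => series (exp_coeff (u x)) n) _ (expR K)).
- move=> n; apply: (multiplier_sum _ _ (fun k x => exp_coeff (u x) k)) => k.
  rewrite /exp_coeff/=; under eq_fun do rewrite mulrC.
  by apply: multiplierZ; exact: multiplierX.
- move=> n x; apply: (le_trans (ler_norm_sum _ _ _)).
  apply: (@le_trans _ _ (series (exp_coeff `|u x|) n)).
    by apply: ler_sum => k _; rewrite /exp_coeff/= normrM normrX normfV normr_nat.
  by rewrite (le_trans (series_exp_coeff_le _ _ _ _))// ler_expR.
- by move=> x; exact: is_cvg_series_exp_coeff.
Qed.

Lemma multiplier_gt0 u : multiplier u -> multiplier (fun x => (0 < u x)%R%:R).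
Proof.
move=> mu; pose a n x : R := n%:R - n%:R ^+ 2 * u x.
apply: (multiplier_cvg (fun n x => expR (- expR (a n x))) _ 1).
- move=> n; apply: multiplier_expR; under eq_fun do rewrite -mulN1r.
  apply/multiplierZ/multiplier_expR/multiplierB; first exact: multiplier_cst.
  exact: multiplierZ.
- by move=> n x; rewrite ger0_norm ?expR_ge0// expR_le1 oppr_le0 expR_ge0.
- by move=> x; exact: expR_opp_expR_cvg.
Qed.

(** For fixed x and c, once [r k] is small both [r k * x] and [r k * c] lie in [- pi / 2, pi / 2],
    where sin increases. The sign of the difference of the sines then decides c < x, so the sequence
    is eventually constant. *)
Lemma multiplier_ray c : multiplier (fun x => (c < x)%R%:R).
Proof.
pose r k := s / 4 / k.+1%:R.
have s40 : 0 < s / 4 by rewrite divr_gt0.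
have r0 k : 0 < r k by rewrite divr_gt0.
have rs k : 4 * r k <= s.
  rewrite /r mulrA [4 * _]mulrC divfK// ler_pdivrMr// ler_peMr ?ler1n// ltW//.
apply: (multiplier_cvg (fun k x => (0 < sin (r k * x) - sin (r k * c))%R%:R) _ 1).
- move=> k; apply: multiplier_gt0; apply: multiplierB; last exact: multiplier_cst.
  exact: multiplier_sin.
- by move=> k x; case: (0 < _); rewrite ?normr1 ?normr0.
- move=> x; apply: cvg_near_cst; near=> k.
  have small y : `|y| <= `|x| + `|c| -> r k * y \in `[(- (pi / 2)), (pi / 2)].
    move=> yxc; rewrite in_itv/= -ler_norml normrM (gtr0_norm (r0 k)).
    rewrite (le_trans (ler_wpM2l (ltW (r0 k)) yxc))// /r mulrAC ler_pdivrMr//.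
    rewrite -ler_pdivrMl ?divr_gt0 ?pi_gt0//.
    apply: (@le_trans _ _ k%:R); last by rewrite ler_nat.
    by near: k; exact: nbhs_infty_ger.
  by rewrite subr_gt0 ltr_sin ?small ?lerDl ?lerDr// ltr_pM2l.
Unshelve. all: by end_near. Qed.

(** The sets whose indicator is a multiplier form a sigma-algebra, and it contains the open rays,
    which generate the Borel sets. *)
Lemma multiplier_indic (A : set R) : measurable A -> multiplier \1_A.
Proof.
move=> mA; rewrite -[measurable A]/(((@ocitv R).-sigma.-measurable) A) in mA.
rewrite RGenOInfty.measurableE in mA; move: A mA; apply: smallest_sub.
  split => /=.
  - by rewrite indic0; exact: multiplier_cst.
  - move=> B mB; have -> : \1_(setT `\` B) = (fun x => 1 - \1_B x) :> (R -> R).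
      apply/funext => x; rewrite setTD !indicE in_setC.
      by case: (_ \in _); rewrite ?subrr ?subr0.
    by apply: multiplierB => //; exact: multiplier_cst.
  - move=> F mF.
    (* The complement of the union has as indicator the limit of the finite products of the 1 - 1_(F
       k): such a product drops to 0 as soon as some F k contains x, and stays at 1 otherwise. *)
    have -> : \1_(\bigcup_n F n) = (fun x => 1 - \1_(~` \bigcup_n F n) x) :> (R -> R).
      apply/funext => x; rewrite !indicE in_setC.
      by case: (_ \in _); rewrite ?subrr ?subr0.
    apply: multiplierB; first exact: multiplier_cst.
    apply: (multiplier_cvg (fun n x => \prod_(k < n) (1 - \1_(F k) x)) _ 1).
    + elim=> [|n IH]; first by under eq_fun do rewrite big_ord0; exact: multiplier_cst.
      under eq_fun do rewrite big_ord_recr/=.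
      by apply: multiplierM => //; apply: multiplierB => //; exact: multiplier_cst.
    + move=> n x; rewrite normr_prod; apply: prodr_ile1 => k _.
      rewrite normr_ge0/= indicE.
      by case: (_ \in _); rewrite ?subrr ?normr0 ?subr0 ?normr1.
    + move=> x; apply: cvg_near_cst; rewrite indicE in_setC.
      have [[m _ Fmx]|Fx] := pselect ((\bigcup_n F n) x).
        rewrite mem_set/=; last by exists m.
        near=> n; have mn : (m < n)%N by near: n; exact: nbhs_infty_gt.
        by rewrite (bigD1 (Ordinal mn))//= indicE mem_set// subrr mul0r.
      rewrite memNset//=; apply: nearW => n; apply: big1 => k _.
      by rewrite indicE memNset ?subr0// => Fkx; apply: Fx; exists k.
move=> _ [c ->]; have := multiplier_ray c.
congr multiplier; apply/funext => x; rewrite indicE; congr (nat_of_bool _)%:R.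
by apply/idP/idP; rewrite inE/= in_itv/= andbT.
Unshelve. all: by end_near. Qed.

Import HBNNSimple.

Lemma multiplier_nnsfun (f : {nnsfun R >-> R}) : multiplier f.
Proof.
have -> : (f : R -> R) = fun x => \sum_(y <- finmap.enum_fset (fset_set (range f)))
    (y * \1_(f @^-1` [set y]) x).
  by apply/funext => x; rewrite fimfunE fsbig_finite.
apply: (multiplier_sum _ _ (fun y x => y * \1_(f @^-1` [set y]) x)) => y.
apply: multiplierZ; apply: multiplier_indic.
exact: (measurable_funPTI f).
Qed.

(** Simple functions increase to f from below, so the distance to f is dominated by f itself. *)
Lemma poly_approx_ge0 f : measurable_fun setT f -> (forall x, 0 <= f x) ->
  (\int[P]_w ((f (Y w)) ^+ 2)%:E < +oo)%E -> poly_approx f.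
Proof.
move=> mf f0 fI.
have mEf : measurable_fun [set: R] (EFin \o f).
  exact/measurable_EFinP.
apply: (poly_approx_cvg (fun n => nnsfun_approx measurableT mEf n) _ f) => //.
- move=> n; have [_ _ /(_ 1)] := multiplier_nnsfun (nnsfun_approx measurableT mEf n).
  by under eq_fun do rewrite hornerC mulr1.
- move=> n x.
  have h : ((nnsfun_approx measurableT mEf n) x <= f x).
    rewrite -lee_fin nnsfun_approxE; apply: (@le_approx _ _ _ setT (EFin \o f)) => //.
    by move=> y _; rewrite lee_fin.
  have h0 : 0 <= nnsfun_approx measurableT mEf n x by [].
  by rewrite ger0_norm ?subr_ge0// gerBl.
- move=> x; have f0' y : [set: R] y -> (0 <= (EFin \o f) y)%E by rewrite lee_fin.
  have := cvg_nnsfun_approx measurableT mEf f0' Logic.I => /(_ x).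
  exact: fine_cvg.
Qed.

Theorem polynomials_dense f : measurable_fun setT f ->
  (\int[P]_w ((f (Y w)) ^+ 2)%:E < +oo)%E -> poly_approx f.
Proof.
move=> mf fI.
have sub g : measurable_fun setT g -> (forall x, `|g x| <= `|f x|) ->
    (\int[P]_w ((g (Y w)) ^+ 2)%:E < +oo)%E.
  move=> mg gf; apply: le_lt_trans fI; apply: le_integral_EFin => [|||w].
  - by apply: (measurable_compY (fun x => g x ^+ 2)); exact: measurable_funX.
  - by apply: (measurable_compY (fun x => f x ^+ 2)); exact: measurable_funX.
  - by move=> w; exact: sqr_ge0.
  - rewrite -[leLHS]real_normK ?num_real// -[leRHS]real_normK ?num_real//.
    by rewrite lerXn2r ?nnegrE.
have mp : measurable_fun setT f^\+ by exact: measurable_funrpos.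
have mn : measurable_fun setT f^\- by exact: measurable_funrneg.
have ap : poly_approx f^\+.
  apply: poly_approx_ge0 => //; apply: sub => // x.
  by rewrite ger0_norm// /funrpos; case: (leP (f x) 0) => // _; exact: ler_norm.
have an : poly_approx (fun x => (-1) * f^\- x).
  apply: poly_approx_mult => //; first exact: multiplier_cst.
  apply: poly_approx_ge0 => //; apply: sub => // x.
  rewrite ger0_norm// /funrneg; case: (leP (- f x) 0) => // _.
  by rewrite -normrN; exact: ler_norm.
have -> : f = fun x => f^\+ x + (-1) * f^\- x.
  by apply/funext => x; rewrite mulN1r -[LHS](congr1 (@^~ x) (funrposBneg f)).
by apply: poly_approxD => //; exact: measurable_funM.
Qed.

End polynomial_density.

(** * The Gaussian channel *)

Section density_integral.
Local Open Scope ereal_scope.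
Context d (T : measurableType d) (R : realType).
Variables (mu nu : {measure set T -> \bar R}) (p : T -> R).
Hypothesis mp : measurable_fun setT p.
Hypothesis p0 : forall x, (0 <= p x)%R.
Hypothesis nuE : forall A, measurable A -> nu A = \int[mu]_(x in A) (p x)%:E.

Import HBNNSimple.

(** By [nuE] this holds for indicators, by linearity for simple functions, and monotone convergence
    on both sides gives the general case. *)
Lemma ge0_integral_density (f : T -> \bar R) :
  measurable_fun setT f -> (forall x, 0 <= f x) ->
  \int[nu]_x f x = \int[mu]_x (f x * (p x)%:E).
Proof.
move=> mf f0; pose h := nnsfun_approx measurableT mf.
have mep : measurable_fun setT (EFin \o p) by exact/measurable_EFinP.
have -> : \int[nu]_x f x = lim (\int[nu]_x (EFin \o h n) x @[n --> \oo]).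
  have fE x : f x = lim ((EFin \o h n) x @[n --> \oo]).
    by apply/esym/cvg_lim => //; exact: cvg_nnsfun_approx.
  under eq_integral do rewrite fE.
  apply: monotone_convergence => //.
  - by move=> n; exact/measurable_EFinP.
  - by move=> n x _ /=; rewrite lee_fin.
  - by move=> x _ a b ab; rewrite lee_fin; exact/lefP/nd_nnsfun_approx.
have -> : \int[mu]_x (f x * (p x)%:E) =
    lim (\int[mu]_x ((h n x)%:E * (p x)%:E) @[n --> \oo]).
  have fE x : f x * (p x)%:E = lim (((h n x)%:E * (p x)%:E) @[n --> \oo]).
    apply/esym/cvg_lim => //; apply: cvgeZr => //.
    exact: cvg_nnsfun_approx.
  under eq_integral do rewrite fE.
  apply: monotone_convergence => //.
  - by move=> n; apply: emeasurable_funM => //; exact/measurable_EFinP.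
  - by move=> n x _; rewrite mule_ge0 ?lee_fin.
  - move=> x _ a b ab; rewrite lee_wpmul2r ?lee_fin//.
    exact/lefP/nd_nnsfun_approx.
suff suf n : \int[nu]_x (EFin \o h n) x = \int[mu]_x ((h n x)%:E * (p x)%:E).
  by under eq_fun do rewrite suf.
transitivity (\int[nu]_x
   (\sum_(y \in range (h n)) (y * \1_(h n @^-1` [set y]) x)%:E)).
  by apply: eq_integral => x _; rewrite /= fimfunE -fsumEFin.
have mh r : measurable_fun setT (fun x => (r * \1_(h n @^-1` [set r]) x)%:E).
  by apply: (measurable_comp measurableT) => //; exact: measurable_funM.
rewrite ge0_integral_fsum//; last by move=> y x _; exact: nnfun_muleindic_ge0.
transitivity (\int[mu]_x (\sum_(y \in range (h n))
    (y * \1_(h n @^-1` [set y]) x)%:E * (p x)%:E)); last first.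
  apply: eq_integral => x _.
  rewrite -ge0_mule_fsuml => [|y]; last exact: nnfun_muleindic_ge0.
  by rewrite fsumEFin // -(fimfunE _ x).
rewrite ge0_integral_fsum//; first last.
- move=> y x _; apply: mule_ge0; first exact: nnfun_muleindic_ge0.
  by rewrite lee_fin.
- by move=> y; exact: emeasurable_funM.
apply: eq_fsbigr => r rhn.
under [LHS]eq_integral do rewrite EFinM.
rewrite integralZl_indic_nnsfun//.
under [RHS]eq_integral do rewrite EFinM -muleA.
rewrite ge0_integralZl//.
- under [in RHS]eq_integral do rewrite muleC.
  rewrite integral_indic// setIT nuE//.
  rewrite [in RHS](eq_integral ((EFin \o p) \_ (h n @^-1` [set r]))); last first.
    by move=> x _; rewrite epatch_indic.
  by rewrite -integral_mkcond.
- by apply: emeasurable_funM => //; exact/measurable_EFinP.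
- by move=> x _; rewrite mule_ge0 ?lee_fin.
- by move: rhn; rewrite inE => -[t _ <-]; rewrite lee_fin.
Qed.

End density_integral.

(* Lebesgue measure lives on [measurableTypeR R], whose measure display differs from
   that of [R] although both carry the same measurable sets. *)
Lemma ge0_integral_translation (R : realType) (a : R) (f : R -> \bar R) :
  measurable_fun setT f -> (forall x, (0 <= f x)%E) ->
  (\int[lebesgue_measure]_x f (a + x)%R = \int[lebesgue_measure]_x f x)%E.
Proof.
move=> mf f0.
have ma : measurable_fun setT
    ((fun x => a + x) : measurableTypeR R -> measurableTypeR R).
  by apply: measurable_funD => //; exact: measurable_cst.
rewrite -[LHS](ge0_integral_pushforward ma lebesgue_measure (D := setT) (f := f))//.
(* The pushforward of Lebesgue measure under the translation agrees with it on half-open intervals,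
   which determine the measure. *)
apply: eq_measure_integral => A mA _; apply/esym/lebesgue_measure_unique => //.
move=> _ [[x y]] _ <-.
rewrite [RHS](_ : _ = lebesgue_measure `]x - a, y - a]%classic); last first.
  rewrite /= /pushforward; congr (lebesgue_measure _).
  apply/seteqP; split => z/=; rewrite !in_itv/= => /andP[? ?]; apply/andP; split; lra.
rewrite !lebesgue_measure_itv/= !lte_fin ltrD2r -!EFinB.
by rewrite opprB addrA subrK.
Qed.

Lemma ge0_integral_normal_prob (R : realType) (m sd : R) (f : R -> \bar R) :
  measurable_fun setT f -> (forall x, (0 <= f x)%E) ->
  (\int[normal_prob m sd]_x f x =
   \int[lebesgue_measure]_x (f x * (normal_pdf m sd x)%:E))%E.
Proof.
move=> mf f0.
by apply: (ge0_integral_density _ (measurableTypeR R) R lebesgue_measure _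
  (normal_pdf m sd)) => // [|x]; [exact: measurable_normal_pdf|exact: normal_pdf_ge0].
Qed.

Section gaussian_channel.
Context {d} {T : measurableType d} {R : realType} (P : probability T R).
Variables (X N : {RV P >-> R}).
Hypothesis XN : independent_RV P X N.
Hypothesis NN : std_normal N.

Let phi : R -> R := normal_pdf 0 1.

Lemma integral_std_normal (f : R -> \bar R) :
  measurable_fun setT f -> (forall x, (0 <= f x)%E) ->
  (\int[P]_w f (N w) = \int[lebesgue_measure]_x (f x * (phi x)%:E))%E.
Proof.
move=> mf f0.
have mN : measurable_fun setT (N : T -> measurableTypeR R).
  exact: (measurable_funPT N).
rewrite -(ge0_integral_pushforward mN P (D := setT) (f := f))//.
rewrite (ge0_integral_density _ (measurableTypeR R) R lebesgue_measure _ phi)//.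
- exact: measurable_normal_pdf.
- by move=> x; exact: normal_pdf_ge0.
Qed.

(** Independence says that the law of (X, N) agrees with the product of the marginal laws on
    rectangles; uniqueness of the product measure and Tonelli's theorem conclude. *)
Lemma integral_independent (F : R * measurableTypeR R -> \bar R) :
  measurable_fun setT F -> (forall z, (0 <= F z)%E) ->
  (\int[P]_w F (X w, N w) =
   \int[distribution P X]_x \int[normal_prob 0 1]_n F (x, n))%E.
Proof.
move=> mF F0.
have mXN : measurable_fun setT (fun w => (X w, N w) : R * measurableTypeR R).
  apply/measurable_fun_pairP; split; first exact: (measurable_funPT X).
  exact: (measurable_funPT N).
rewrite -(ge0_integral_pushforward mXN P (D := setT) (f := F))//.
rewrite -[RHS](@fubini_tonelli1 _ _ R (measurableTypeR R) R
  (distribution P X) (normal_prob 0 1))//.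
apply: eq_measure_integral => A mA _; apply/esym.
apply: (@product_measure_unique _ _ R (measurableTypeR R) R) => // B C mB mC.
rewrite /pushforward; have := XN B C mB mC.
by rewrite (_ : P (N @^-1` C) = distribution P N C)// NN.
Qed.

(** Given X = x, the output a x + N has density phi (y - a x): the inner integral is translated by a
    x, and Tonelli's theorem moves y outside. The parameter a then occurs in the density only. *)
Theorem gaussian_channelE (a : R) (F : R * R -> \bar R) :
  measurable_fun setT F -> (forall z, (0 <= F z)%E) ->
  (\int[P]_w F (X w, a * X w + N w)%R =
   \int[lebesgue_measure]_y \int[P]_w (F (X w, y) * (phi (y - a * X w))%:E))%E.
Proof.
move=> mF F0.
have mphi : measurable_fun setT phi by exact: measurable_normal_pdf.
have mphiE (x : R) : measurable_fun setT (fun y : R => (phi (y - a * x))%:E).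
  apply/measurable_EFinP; apply: (measurableT_comp mphi).
  by apply: measurable_funB => //; exact: measurable_cst.
pose G (z : R * measurableTypeR R) := (F z * (phi ((z.2 : R) - a * z.1))%:E)%E.
have mF' : measurable_fun [set: R * measurableTypeR R] F by exact: mF.
have mG : measurable_fun setT G.
  apply: emeasurable_funM => //; apply/measurable_EFinP.
  apply: (measurableT_comp mphi); apply: measurable_funB.
    exact: (@measurable_snd _ _ R (measurableTypeR R)).
  apply: measurable_funM; first exact: measurable_cst.
  exact: (@measurable_fst _ _ R (measurableTypeR R)).
have G0 z : (0 <= G z)%E by rewrite mule_ge0 ?lee_fin ?normal_pdf_ge0.
have mFx (x : R) : measurable_fun setT (fun y : R => F (x, y)).
  exact: (measurable_fun_pair2 _ mF).
rewrite (integral_independent (fun z => F (z.1, a * z.1 + z.2))) //; last first.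
  apply: (measurableT_comp mF); apply/measurable_fun_pairP; split.
    exact: (@measurable_fst _ _ R (measurableTypeR R)).
  apply: measurable_funD; last exact: (@measurable_snd _ _ R (measurableTypeR R)).
  apply: measurable_funM; first exact: measurable_cst.
  exact: (@measurable_fst _ _ R (measurableTypeR R)).
transitivity (\int[distribution P X]_x \int[lebesgue_measure]_y G (x, y))%E.
  apply: eq_integral => x _.
  rewrite -(ge0_integral_translation _ (a * x) (fun y => G (x, y)))//=; last first.
    exact: (emeasurable_funM (mFx x) (mphiE x)).
  have mD : measurable_fun setT (fun y : R => a * x + y).
    by apply: measurable_funD => //; exact: measurable_cst.
  rewrite (ge0_integral_normal_prob _ _ _ (fun y => F (x, a * x + y))
    (measurableT_comp (mFx x) mD) (fun=> F0 _)).
  by apply: eq_integral => y _; rewrite /G/= [a * x + _]addrC addrK.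
rewrite (@fubini_tonelli _ _ R (measurableTypeR R) R
  (distribution P X) lebesgue_measure)//.
apply: eq_integral => y _.
rewrite ge0_integral_distribution//.
exact: (measurable_fun_pair1 y mG).
Qed.

End gaussian_channel.

(** * Exponential moments of the signal and of the noise *)

Lemma expR_norm_le (R : realType) (r x : R) :
  expR (r * `|x|) <= expR (r * x) + expR (- r * x).
Proof.
have [x0|x0] := leP 0 x; first by rewrite ger0_norm// lerDl expR_ge0.
by rewrite ltr0_norm// mulNr mulrN lerDr expR_ge0.
Qed.

Section exponential_moments.
Context {d} {T : measurableType d} {R : realType} (P : probability T R).

Lemma has_mgf_expR_norm (X : {RV P >-> R}) : has_mgf P X ->
  exists2 r, 0 < r & (\int[P]_w (expR (r * `|X w|))%:E < +oo)%E.
Proof.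
move=> [a [a0 aX]]; exists (a / 2); first by rewrite divr_gt0.
have mX : measurable_fun setT X by exact: measurable_funPT.
have mM s : measurable_fun setT (fun w => expR (s * X w)).
  by apply: measurableT_comp => //; exact: measurable_funM.
have h s : -a < s < a -> (\int[P]_w (expR (s * X w))%:E < +oo)%E.
  move=> /aX; rewrite /mmt_gen_fun unlock; congr (_ < _)%E.
  by apply: eq_integral => w _ /=; rewrite mulrC.
apply: (@le_lt_trans _ _
  (\int[P]_w ((expR (a / 2 * X w))%:E + (expR (- (a / 2) * X w))%:E))%E).
  under [leRHS]eq_integral do rewrite -EFinD.
  apply: le_integral_EFin => [|||w].
  - exact: measurable_expR_norm.
  - exact: (measurable_funD (mM _) (mM _)).
  - by move=> w; exact: expR_ge0.
  - exact: expR_norm_le.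
rewrite ge0_integralD//; first last.
- exact/measurable_EFinP.
- exact/measurable_EFinP.
by apply: lte_add_pinfty; apply: h; apply/andP; split; lra.
Qed.

(** Comparison with the normal density of variance 2: r |x| - x^2 / 2 <= r^2 - x^2 / 4, the
    difference being (r - |x| / 2)^2. The constant [C] collects exp (r^2) and the ratio of the
    peaks. *)
Lemma std_normal_expR_norm (N : {RV P >-> R}) (r : R) : std_normal N ->
  (\int[P]_w (expR (r * `|N w|))%:E < +oo)%E.
Proof.
move=> NN.
have mE : measurable_fun setT (fun x : R => expR (r * `|x|)).
  by apply: measurableT_comp => //; apply: measurable_funM.
have mn m s : measurable_fun setT (fun x : R => normal_pdf m s x).
  exact: measurable_normal_pdf.
rewrite (integral_std_normal P N NN (fun x => (expR (r * `|x|))%:E))//; last first.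
  exact/measurable_EFinP.
pose s2 : R := Num.sqrt 2.
have s20 : s2 != 0 by rewrite gt_eqF// sqrtr_gt0.
pose C := @normal_peak R 1 * expR (r ^+ 2) / normal_peak s2.
have p1 := normal_peak_ge0 (1 : R).
have p2 : 0 < normal_peak s2 by exact: normal_peak_gt0.
have C0 : 0 <= C by rewrite divr_ge0 ?mulr_ge0 ?expR_ge0// ltW.
apply: (@le_lt_trans _ _
  (\int[lebesgue_measure]_x (C%:E * (normal_pdf 0 s2 x)%:E))%E); last first.
  rewrite ge0_integralZl//.
  - by rewrite integral_normal_pdf mule1 ltry.
  - by apply/measurable_EFinP; exact: mn.
  - by move=> x _; rewrite lee_fin normal_pdf_ge0.
apply: ge0_le_integral => //.
- by move=> x _; rewrite mule_ge0 ?lee_fin ?expR_ge0 ?normal_pdf_ge0.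
- by apply: emeasurable_funM; apply/measurable_EFinP; [exact: mE|exact: mn].
- by apply: emeasurable_funM => //; apply/measurable_EFinP; exact: mn.
- move=> x _; rewrite -!EFinM lee_fin !normal_pdfE ?oner_neq0// /normal_fun.
  rewrite subr0 expr1n sqr_sqrtr//.
  rewrite /C mulrACA mulrAC [leRHS](_ : _ = normal_peak 1 *
    (expR (r ^+ 2) * expR (- x ^+ 2 / (2 *+ 2)))); last first.
    by field; rewrite gt_eqF.
  rewrite mulrCA ler_wpM2l// -!expRD ler_expR.
  have -> : x ^+ 2 = `|x| ^+ 2 by rewrite real_normK ?num_real.
  move: (`|x|%R : R) => z; rewrite -subr_ge0.
  rewrite (_ : _ - _ = (r - z / 2) ^+ 2) ?sqr_ge0//.
  by field.
Qed.

(** The sum b |X| + |N| is at most twice its larger term, so its exponential at rate s is at most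
    exp (r |X|) + exp (2 s |N|) once 2 s b <= r. The [b + 1] in the choice of s covers b = 0. *)
Lemma expR_norm_linear (X N : {RV P >-> R}) (b : R) : 0 <= b ->
  has_mgf P X -> std_normal N ->
  exists2 s, 0 < s & (\int[P]_w (expR (s * (b * `|X w| + `|N w|)))%:E < +oo)%E.
Proof.
move=> b0 /has_mgf_expR_norm[r r0 rX] NN.
have b1 : 0 < 2 * (b + 1) by lra.
exists (r / (2 * (b + 1))); first by rewrite divr_gt0.
set s := r / _; have s0 : 0 < s by rewrite divr_gt0.
have mX : measurable_fun setT X by exact: measurable_funPT.
have mN : measurable_fun setT N by exact: measurable_funPT.
apply: (@le_lt_trans _ _
  (\int[P]_w ((expR (r * `|X w|))%:E + (expR (2 * s * `|N w|))%:E))%E).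
  under [leRHS]eq_integral do rewrite -EFinD.
  apply: le_integral_EFin => [|||w].
  - apply: measurableT_comp => //; apply: measurable_funM => //.
    apply: measurable_funD; last exact: measurableT_comp.
    by apply: measurable_funM => //; exact: measurableT_comp.
  - exact: (measurable_funD (measurable_expR_norm _ _ mX)
      (measurable_expR_norm _ _ mN)).
  - by move=> w; exact: expR_ge0.
  - have sb : 2 * s * b <= r.
      by rewrite /s mulrA mulrAC ler_pdivrMr// mulrCA mulrAC; nra.
    have [XN|XN] := leP (b * `|X w|) `|N w|.
      rewrite (le_trans _ (_ : expR (2 * s * `|N w|) <= _))//; last first.
        by rewrite lerDr expR_ge0.
      by rewrite ler_expR; have := ler_wpM2l (ltW s0) XN; lra.
    rewrite (le_trans _ (_ : expR (r * `|X w|) <= _))//; last first.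
      by rewrite lerDl expR_ge0.
    rewrite ler_expR; apply: (@le_trans _ _ (2 * s * b * `|X w|)).
      by have := ler_wpM2l (ltW s0) (ltW XN); lra.
    by rewrite ler_wpM2r.
rewrite ge0_integralD//; first last.
- by apply/measurable_EFinP; exact: measurable_expR_norm.
- by apply/measurable_EFinP; exact: measurable_expR_norm.
by apply: lte_add_pinfty => //; exact: std_normal_expR_norm.
Qed.

End exponential_moments.

Lemma std_normal_pdf_gt0 (R : realType) (x : R) : 0 < normal_pdf 0 1 x.
Proof.
rewrite normal_pdfE ?oner_neq0// mulr_gt0 ?expR_gt0//.
by rewrite normal_peak_gt0 ?oner_neq0.
Qed.

(** * Lower semicontinuity of the Bayes risk *)

Section posterior.
Context {d} {T : measurableType d} {R : realType} (P : probability T R).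
Variables (X N : {RV P >-> R}).
Implicit Types (a c y : R) (k : nat).
Hypothesis XN : independent_RV P X N.
Hypothesis NN : std_normal N.
Hypothesis iX2 : (\int[P]_w ((X w) ^+ 2)%:E < +oo)%E.

Local Notation phi := (normal_pdf 0 1 : R -> R).
Local Notation weight a y := (fun w => phi (y - a * X w)).

Local Lemma continuous_phi (x : R) : phi z @[z --> x] --> phi x.
Proof.
rewrite (normal_pdfE _ (oner_neq0 _)); apply: cvgMl_tmp.
apply: (cvg_comp _ expR); last exact: continuous_expR.
have cB : z - 0 @[z --> x] --> x - 0.
  by apply: cvgB; [exact: cvg_id|exact: cvg_cst].
by apply: cvgMr_tmp; apply: cvgN; exact: (cvgM cB cB).
Qed.

Local Lemma measurable_weight (a y : R) : measurable_fun setT (weight a y).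
Proof.
apply: (measurableT_comp (measurable_normal_pdf 0 1)).
by apply: measurable_funB => //; apply: measurable_funM.
Qed.

(** For k <= 2 one has |x|^k <= 1 + x^2, and phi is at most its peak. The bound is uniform in a and
    y, so it can dominate a sequence of channels. *)
Local Lemma norm_moment_le k (a y : R) w : (k <= 2)%N ->
  `|X w ^+ k * weight a y w| <= (1 + X w ^+ 2) * @normal_peak R 1.
Proof.
move=> k2; rewrite normrM [X in _ * X]ger0_norm ?normal_pdf_ge0// ler_pM//.
- by rewrite normal_pdf_ge0.
- rewrite normrX; have := sqr_ge0 (`|X w| - 1).
  rewrite -[X w ^+ 2]real_normK ?num_real//.
  have := normr_ge0 (X w); move: (`|X w|%R) => x.
  by case: k k2 => [|[|[|//]]] _ x0; rewrite ?expr0 ?expr1; nra.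
- by rewrite normal_pdf_ub ?oner_neq0.
Qed.

Local Lemma integrable_dominator :
  P.-integrable setT (fun w => ((1 + X w ^+ 2) * @normal_peak R 1)%:E).
Proof.
have m2 : measurable_fun setT (fun w => 1 + X w ^+ 2).
  by apply: measurable_funD => //; apply: measurable_funX; exact: (measurable_funPT X).
apply/integrableP; split.
  by apply/measurable_EFinP; apply: measurable_funM.
under eq_integral.
  move=> w _; rewrite gee0_abs; last first.
    by rewrite lee_fin mulr_ge0 ?normal_peak_ge0// addr_ge0 ?sqr_ge0.
  rewrite EFinM; over.
rewrite ge0_integralZr//; first last.
- by rewrite lee_fin normal_peak_ge0.
- by move=> w _; rewrite lee_fin addr_ge0 ?sqr_ge0.
- exact/measurable_EFinP.
under eq_integral do rewrite EFinD.
rewrite ge0_integralD//; last first.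
  by apply/measurable_EFinP; apply: measurable_funX; exact: (measurable_funPT X).
rewrite integral_cst//= probability_setT mule1.
have h0 : (0 <= 1 + \int[P]_w (X w ^+ 2)%:E)%E by rewrite adde_ge0// integral_ge0.
apply: lte_mul_pinfty => //; last exact: ltry.
by rewrite ge0_fin_numE// lte_add_pinfty// ltry.
Qed.

Local Lemma measurable_momentW k a y :
  measurable_fun setT (fun w => (X w ^+ k * weight a y w)%:E).
Proof.
apply/measurable_EFinP; apply: measurable_funM; last exact: measurable_weight.
by apply: measurable_funX; exact: (measurable_funPT X).
Qed.

Local Lemma integrable_moment k a y : (k <= 2)%N ->
  P.-integrable setT (fun w => (X w ^+ k * weight a y w)%:E).
Proof.
move=> k2; apply: (le_integrable measurableT _ _ integrable_dominator).
- exact: measurable_momentW.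
- move=> w _; rewrite /= lee_fin (le_trans (norm_moment_le _ _ _ _ k2))//.
  exact: ler_norm.
Qed.

(** The Ak of the overview; A0 is the density of a X + N at y. For k <= 2 the integral is finite
    ([momentE]), so [fine] loses nothing. *)
Definition moment k a y : R := fine (\int[P]_w (X w ^+ k * weight a y w)%:E)%E.

Local Lemma momentE k a y : (k <= 2)%N ->
  (\int[P]_w (X w ^+ k * weight a y w)%:E)%E = (moment k a y)%:E.
Proof.
by move=> k2; rewrite fineK// integrable_fin_num//; exact: integrable_moment.
Qed.

(** Bayes' formula for E[X | a X + N = y]. *)
Definition posterior_mean a y : R := moment 1 a y / moment 0 a y.

(* Expected loss of the guess c for X on the observation y of a X + N, times the
   density of a X + N at y. *)
Definition posterior_risk (c a y : R) : \bar R :=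
  (\int[P]_w ((X w - c) ^+ 2 * weight a y w)%:E)%E.

Lemma posterior_riskE c a y : posterior_risk c a y =
  (moment 2 a y - 2 * c * moment 1 a y + c ^+ 2 * moment 0 a y)%:E.
Proof.
rewrite !EFinD EFinN [in RHS]EFinM [(c ^+ 2 * _)%:E]EFinM -!momentE//.
rewrite -!integralZl//; try exact: integrable_moment.
rewrite -integralB//; first last.
- by apply: integrableZl => //; exact: integrable_moment.
- exact: integrable_moment.
rewrite -integralD//; first last.
- by apply: integrableZl => //; exact: integrable_moment.
- apply: integrableB => //; first exact: integrable_moment.
  by apply: integrableZl => //; exact: integrable_moment.
apply: eq_integral => w _.
by rewrite -!EFinM -EFinN -!EFinD; congr EFin; rewrite expr0; ring.
Qed.

(** The weight is positive everywhere; a zero integral would make it vanish almost everywhere and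
    the whole space negligible. *)
Local Lemma moment0_gt0 a y : 0 < moment 0 a y.
Proof.
rewrite -lte_fin -momentE// lt_neqAle integral_ge0 ?andbT; last first.
  by move=> w _; rewrite lee_fin expr0 mul1r normal_pdf_ge0.
apply/eqP => /esym h0.
have /ae_eq_integral_abs : (\int[P]_w `|(X w ^+ 0 * weight a y w)%:E| = 0)%E.
  rewrite -[RHS]h0; apply: eq_integral => w _.
  by rewrite gee0_abs// lee_fin expr0 mul1r normal_pdf_ge0.
move=> /(_ measurableT (measurable_momentW _ _ _)) [A [mA A0 AT]].
have : (P setT <= P A)%E.
  apply: le_measure; rewrite ?inE// => w _; apply: AT => /= /(_ Logic.I).
  move=> [] /eqP; rewrite expr0 mul1r; apply/negP.
  by rewrite gt_eqF// std_normal_pdf_gt0.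
by rewrite A0 probability_setT lee_fin ler10.
Qed.

Local Lemma posterior_risk_meanE a y : posterior_risk (posterior_mean a y) a y =
  (moment 2 a y - moment 1 a y ^+ 2 / moment 0 a y)%:E.
Proof.
rewrite posterior_riskE /posterior_mean; congr EFin; field.
by rewrite gt_eqF// moment0_gt0.
Qed.

(** Completing the square in c: the excess risk is A0 (c - A1 / A0)^2. *)
Lemma posterior_mean_min c a y :
  (posterior_risk (posterior_mean a y) a y <= posterior_risk c a y)%E.
Proof.
rewrite posterior_risk_meanE posterior_riskE lee_fin -subr_ge0.
have m0 := moment0_gt0 a y.
suff -> : moment 2 a y - 2 * c * moment 1 a y + c ^+ 2 * moment 0 a y -
    (moment 2 a y - moment 1 a y ^+ 2 / moment 0 a y) =
  moment 0 a y * (c - moment 1 a y / moment 0 a y) ^+ 2.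
  by rewrite mulr_ge0 ?sqr_ge0// ltW.
by field; rewrite gt_eqF.
Qed.

Local Lemma cvg_moment k (v : R^nat) a y : (k <= 2)%N -> v @ \oo --> a ->
  moment k (v n) y @[n --> \oo] --> moment k a y.
Proof.
move=> k2 va; apply: fine_cvg; rewrite -momentE//.
apply: (dominated_cvg measurableT _ _ _ integrable_dominator) => //.
- by move=> n; exact: measurable_momentW.
- move=> w _.
  have vX : y - v n * X w @[n --> \oo] --> y - a * X w.
    by apply: cvgB; [exact: cvg_cst|exact: cvgMr_tmp].
  have phiX : phi (y - v n * X w) @[n --> \oo] --> phi (y - a * X w).
    apply: (cvg_comp (fun n => y - v n * X w) phi vX).
    exact: continuous_phi.
  apply: cvg_EFin; first exact: nearW.
  exact: cvgMl_tmp phiX.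
- by move=> n w _; rewrite lee_fin norm_moment_le.
Qed.

Local Lemma cvg_posterior_risk (v : R^nat) a y : v @ \oo --> a ->
  posterior_risk (posterior_mean (v n) y) (v n) y @[n --> \oo] -->
  posterior_risk (posterior_mean a y) a y.
Proof.
move=> va; rewrite posterior_risk_meanE.
under eq_fun do rewrite posterior_risk_meanE.
apply: cvg_EFin; first exact: nearW.
apply: cvgB; first exact: cvg_moment.
apply: cvgM; last by apply: cvgV; [rewrite gt_eqF// moment0_gt0|exact: cvg_moment].
by apply: cvgM; exact: cvg_moment.
Qed.


Local Lemma measurable_integral_weight (F : R -> R) a : measurable_fun setT F ->
  (forall x, 0 <= F x) ->
  measurable_fun setT (fun y => (\int[P]_w (F (X w) * weight a y w)%:E)%E).
Proof.
move=> mF F0.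
apply: (measurable_fun_fubini_tonelli_G (m1 := P)
  (fun z : T * R => (F (X z.1) * phi (z.2 - a * X z.1))%:E)).
- have mX1 : measurable_fun setT (fun z : T * R => X z.1).
    exact: (measurableT_comp (measurable_funPT X) measurable_fst).
  apply/measurable_EFinP; apply: measurable_funM.
    exact: (measurableT_comp mF mX1).
  apply: (measurableT_comp (measurable_normal_pdf 0 1)).
  by apply: measurable_funB => //; apply: measurable_funM.
- by move=> z; rewrite lee_fin mulr_ge0 ?normal_pdf_ge0.
Qed.

Local Lemma measurable_posterior_risk_cst c a :
  measurable_fun setT (fun y => posterior_risk c a y).
Proof.
apply: (measurable_integral_weight (fun x => (x - c) ^+ 2)).
  by apply: measurable_funX; exact: measurable_funB.
by move=> x; exact: sqr_ge0.
Qed.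

Local Lemma measurable_moment k a : (k <= 2)%N -> measurable_fun setT (moment k a).
Proof.
have m0 : measurable_fun setT (moment 0 a).
  apply: measurableT_comp => //.
  by apply: (measurable_integral_weight (fun x => x ^+ 0)) => // x; rewrite expr0.
have m2 : measurable_fun setT (moment 2 a).
  apply: measurableT_comp => //.
  apply: (measurable_integral_weight (fun x => x ^+ 2)) => // x; exact: sqr_ge0.
case: k => [|[|[|//]]] // _.
(* Measurability from Tonelli's theorem is for nonnegative integrands, whereas X is signed; the
   first moment is recovered from (X - 1)^2 = X^2 - 2 X + 1. *)
have -> : moment 1 a = fun y =>
    (moment 2 a y + moment 0 a y - fine (posterior_risk 1 a y)) / 2.
  by apply/funext => y; rewrite posterior_riskE/=; field.
apply: measurable_funM => //; apply: measurable_funB; first exact: measurable_funD.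
by apply: measurableT_comp => //; exact: measurable_posterior_risk_cst.
Qed.

Local Lemma measurable_momentV a : measurable_fun setT (fun y => (moment 0 a y)^-1).
Proof.
(* The inverse becomes a composition of measurable functions, since A0 > 0. *)
have -> : (fun y => (moment 0 a y)^-1) = fun y => expR (- ln (moment 0 a y)).
  by apply/funext => y; rewrite expRN lnK// posrE moment0_gt0.
apply: measurableT_comp => //; apply: measurableT_comp => //.
by apply: measurableT_comp; [exact: measurable_ln|exact: measurable_moment].
Qed.

Lemma measurable_posterior_mean a : measurable_fun setT (posterior_mean a).
Proof.
apply: measurable_funM; first exact: measurable_moment.
exact: measurable_momentV.
Qed.

(** The m(a) of the overview. The reference measure does not depend on a, which is the form Fatou's
    lemma asks for; [bayes_riskE] identifies the value with the error of the posterior mean. *)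
Definition bayes_risk a : \bar R :=
  (\int[lebesgue_measure]_y posterior_risk (posterior_mean a y) a y)%E.

Lemma integral_sqr_error (g : R -> R) a : measurable_fun setT g ->
  (\int[P]_w ((X w - g (a * X w + N w)) ^+ 2)%:E =
   \int[lebesgue_measure]_y posterior_risk (g y) a y)%E.
Proof.
move=> mg.
rewrite (gaussian_channelE P X N XN NN a
  (fun z => ((z.1 - g z.2) ^+ 2)%:E))//.
apply/measurable_EFinP; apply: measurable_funX; apply: measurable_funB => //.
exact: measurableT_comp.
Qed.

Local Lemma posterior_risk_ge0 c a y : (0 <= posterior_risk c a y)%E.
Proof.
by apply: integral_ge0 => w _; rewrite lee_fin mulr_ge0 ?sqr_ge0 ?normal_pdf_ge0.
Qed.

Local Lemma measurable_posterior_risk (g : R -> R) a : measurable_fun setT g ->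
  measurable_fun setT (fun y => posterior_risk (g y) a y).
Proof.
move=> mg; under eq_fun do rewrite posterior_riskE.
have mk k : (k <= 2)%N -> measurable_fun setT (moment k a).
  by move=> k2; exact: measurable_moment.
apply/measurable_EFinP; apply: measurable_funD.
  apply: measurable_funB; first exact: mk.
  by apply: measurable_funM; [exact: measurable_funM|exact: mk].
by apply: measurable_funM; [exact: measurable_funX|exact: mk].
Qed.

(** The posterior mean is optimal for each y, hence after integration. This serves both for
    polynomials and for any version of the conditional expectation. *)
Lemma bayes_risk_le (g : R -> R) a : measurable_fun setT g ->
  (bayes_risk a <= \int[P]_w ((X w - g (a * X w + N w)) ^+ 2)%:E)%E.
Proof.
move=> mg; rewrite integral_sqr_error//; apply: ge0_le_integral => //.
- by move=> y _; exact: posterior_risk_ge0.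
- apply: measurable_posterior_risk; exact: measurable_posterior_mean.
- exact: measurable_posterior_risk.
- by move=> y _; exact: posterior_mean_min.
Qed.

Lemma bayes_riskE a : bayes_risk a =
  (\int[P]_w ((X w - posterior_mean a (a * X w + N w)) ^+ 2)%:E)%E.
Proof. by rewrite integral_sqr_error//; exact: measurable_posterior_mean. Qed.

Lemma bayes_risk_lty a : (bayes_risk a < +oo)%E.
Proof.
apply: le_lt_trans iX2; have := bayes_risk_le (cst 0) a (measurable_cst _).
by under eq_integral do rewrite subr0.
Qed.

Lemma bayes_risk_lsc (v : R^nat) a : v @ \oo --> a ->
  (bayes_risk a <= limn_einf (fun n => bayes_risk (v n)))%E.
Proof.
move=> va.
have := fatou lebesgue_measure measurableT
  (f := fun n y => posterior_risk (posterior_mean (v n) y) (v n) y).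
move=> /(_ (fun n => measurable_posterior_risk _ (v n)
    (measurable_posterior_mean (v n)))
  (fun n y _ => posterior_risk_ge0 _ _ _)).
(* The integrands converge for every y, so their lower limit is the integrand at a. *)
apply: le_trans; rewrite le_eqVlt; apply/orP; left; apply/eqP.
apply: eq_integral => y _; apply/esym.
by have [] := cvg_limn_einf_sup (cvg_posterior_risk v a y va).
Qed.

End posterior.

(** * Uniform polynomial estimation *)

Section uniform_approximation.
Context {d} {T : measurableType d} {R : realType} (P : probability T R).
Variables (X N : {RV P >-> R}).
Hypothesis XN : independent_RV P X N.
Hypothesis NN : std_normal N.
Hypothesis mgfX : has_mgf P X.

Local Notation Y a := (fun w => a * X w + N w).
Local Notation err p a := (\int[P]_w ((X w - p.[a * X w + N w]) ^+ 2)%:E)%E.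

Local Lemma measurable_channel a : measurable_fun setT (Y a).
Proof.
apply: measurable_funD; last exact: (measurable_funPT N).
by apply: measurable_funM => //; exact: (measurable_funPT X).
Qed.

Local Lemma measurable_err (p : {poly R}) (a : R) :
  measurable_fun setT (fun w => (X w - p.[a * X w + N w]) ^+ 2).
Proof.
apply: measurable_funX; apply: measurable_funB; first exact: (measurable_funPT X).
apply: (measurableT_comp (measurable_horner _ p)).
exact: measurable_channel.
Qed.

(** From (x - q)^2 <= 2 x^2 + 2 q^2, where X^2 and p(Y)^2 are both at most a multiple of exp (s (b
    |X| + |N|)): b >= 1 handles X, and |a| <= b handles Y. One dominating function thus serves all
    |a| <= b. *)
Lemma sqr_error_dominated (p : {poly R}) (b : R) : 1 <= b ->
  exists2 G : T -> R, P.-integrable setT (EFin \o G) &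
    forall a w, `|a| <= b -> (X w - p.[a * X w + N w]) ^+ 2 <= G w.
Proof.
move=> b1; have b0 : 0 <= b by lra.
have [s s0 sXN] := expR_norm_linear P X N b b0 mgfX NN.
have [C C0 HC] := horner_le_expR _ s 'X^2 s0.
have [D D0 HD] := horner_le_expR _ s (p ^+ 2) s0.
pose E w := expR (s * (b * `|X w| + `|N w|)).
have mE : measurable_fun setT E.
  apply: measurableT_comp => //; apply: measurable_funM => //.
  apply: measurable_funD.
    by apply: measurable_funM => //; exact: measurableT_comp.
  by apply: measurableT_comp => //; exact: (measurable_funPT N).
exists (fun w => (2 * C + 2 * D) * E w).
  apply/integrableP; split.
    by apply/measurable_EFinP; apply: measurable_funM.
  under eq_integral.
    move=> w _; rewrite gee0_abs; last first.
      by rewrite lee_fin mulr_ge0 ?expR_ge0// addr_ge0 ?mulr_ge0.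
    rewrite /= EFinM; over.
  rewrite ge0_integralZl//.
  - by rewrite lte_mul_pinfty// lee_fin addr_ge0 ?mulr_ge0.
  - exact/measurable_EFinP.
  - by move=> w _; rewrite lee_fin expR_ge0.
  - by rewrite lee_fin addr_ge0 ?mulr_ge0.
move=> a w ab; set y := a * X w + N w.
have X2 : X w ^+ 2 <= C * E w.
  have := HC (X w); rewrite hornerXn ger0_norm ?sqr_ge0//; move/le_trans; apply.
  rewrite ler_wpM2l// ler_expR ler_wpM2l//; first exact: ltW.
  by rewrite (@le_trans _ _ (b * `|X w|)) ?lerDl// ler_peMl.
have p2 : p.[y] ^+ 2 <= D * E w.
  have := HD y; rewrite horner_exp ger0_norm ?sqr_ge0//; move/le_trans; apply.
  rewrite ler_wpM2l// ler_expR ler_wpM2l//; first exact: ltW.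
  by rewrite (le_trans (ler_normD _ _))// lerD2r normrM ler_wpM2r.
have := sqr_ge0 (X w + p.[y]); move: X2 p2.
move: (X w) (E w) (p.[y]) => x e q; nra.
Qed.

Lemma sqr_error_lty (p : {poly R}) (a : R) : (err p a < +oo)%E.
Proof.
have [|G iG GE] := sqr_error_dominated p (1 + `|a|); first by rewrite lerDl.
have /integrableP[_] : P.-integrable setT
    (fun w => ((X w - p.[a * X w + N w]) ^+ 2)%:E).
  apply: (le_integrable measurableT _ _ iG).
    by apply/measurable_EFinP; exact: measurable_err.
  move=> w _; rewrite !gee0_abs ?lee_fin ?sqr_ge0//.
    by apply: GE; rewrite lerDr.
  by rewrite (le_trans (sqr_ge0 _) (GE a w _))// lerDr.
by under eq_integral do rewrite gee0_abs//.
Qed.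

Lemma cvg_sqr_error (p : {poly R}) (v : R^nat) (a b : R) : 1 <= b ->
  (forall n, `|v n| <= b) -> v @ \oo --> a -> err p (v n) @[n --> \oo] --> err p a.
Proof.
move=> b1 vb va; have [G iG GE] := sqr_error_dominated p b b1.
apply: (dominated_cvg measurableT _ _ _ iG) => //.
- by move=> n; apply/measurable_EFinP; exact: measurable_err.
- move=> w _; apply: cvg_EFin; first exact: nearW.
  have vY : v n * X w + N w @[n --> \oo] --> a * X w + N w.
    by apply: cvgD; [exact: cvgMr_tmp|exact: cvg_cst].
  have pv : p.[v n * X w + N w] @[n --> \oo] --> p.[a * X w + N w].
    by apply: (cvg_comp _ (horner p) vY); exact: continuous_horner.
  have ev : X w - p.[v n * X w + N w] @[n --> \oo] --> X w - p.[a * X w + N w].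
    by apply: cvgB => //; exact: cvg_cst.
  exact: (cvgM ev ev).
- by move=> n w _; rewrite gee0_abs// lee_fin GE.
Qed.

Lemma sqr_integrableX : (\int[P]_w ((X w) ^+ 2)%:E < +oo)%E.
Proof.
have := sqr_error_lty 0 0; congr (_ < _)%E.
by apply: eq_integral => w _; rewrite horner0 subr0.
Qed.

Local Lemma expR_norm_channel (a : R) :
  exists2 s, 0 < s & (\int[P]_w (expR (s * `|a * X w + N w|))%:E < +oo)%E.
Proof.
have [s s0 sXN] := expR_norm_linear P X N `|a| (normr_ge0 a) mgfX NN.
exists s => //; apply: le_lt_trans sXN; apply: le_integral_EFin => [|||w].
- apply: measurable_expR_norm; apply: measurable_funD; last exact: (measurable_funPT N).
  by apply: measurable_funM => //; exact: (measurable_funPT X).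
- apply: measurableT_comp => //; apply: measurable_funM => //.
  apply: measurable_funD.
    by apply: measurable_funM => //; exact: measurableT_comp.
  by apply: measurableT_comp => //; exact: (measurable_funPT N).
- by move=> w; exact: expR_ge0.
- by rewrite ler_expR ler_wpM2l ?(ltW s0)// -normrM; exact: ler_normD.
Qed.

Lemma polynomial_near_bayes (a e : R) : 0 < e ->
  exists p : {poly R}, (err p a <= bayes_risk P X a + e%:E)%E.
Proof.
move=> e0; pose g := posterior_mean P X a.
have mg : measurable_fun setT g.
  exact: (measurable_posterior_mean _ _ sqr_integrableX).
have mY : measurable_fun setT (Y a).
  exact: measurable_channel.
have mgY : measurable_fun setT (g \o Y a) by exact: measurableT_comp.
have BE := bayes_riskE P X N XN NN sqr_integrableX a.
have Blty := bayes_risk_lty P X N XN NN sqr_integrableX a.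
have B0 : (0 <= bayes_risk P X a)%E by rewrite BE integral_ge0.
have [B Beq] : exists B, bayes_risk P X a = B%:E.
  by exists (fine (bayes_risk P X a)); rewrite fineK// ge0_fin_numE.
have BR0 : 0 <= B by rewrite -lee_fin -Beq.
(* Here g(Y) = X + (g(Y) - X), and both terms are square integrable. *)
have gY2 : (\int[P]_w ((g (Y a w)) ^+ 2)%:E < +oo)%E.
  have mgX : measurable_fun setT (fun w => g (Y a w) - X w).
    by apply: measurable_funB => //; exact: (measurable_funPT X).
  have := integral_sqrD_le P X (fun w => g (Y a w) - X w) 1 ltr01
    (measurable_funPT X) mgX.
  under eq_integral do rewrite addrC subrK.
  move/le_lt_trans; apply; apply: lte_add_pinfty.
    by rewrite lte_mul_pinfty ?lee_fin// ?sqr_integrableX// invr1 addr_ge0.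
  rewrite lte_mul_pinfty ?lee_fin ?invr1 ?addr_ge0//.
  under eq_integral do rewrite -sqrrN opprB.
  by rewrite -BE.
(* The target is (1 + eta) B + (1 + 1 / eta) delta <= B + e: each of the two excesses is at most e /
   2, and [B + 1] covers B = 0. *)
pose eta := e / 2 / (B + 1); pose delta := e / 2 / (1 + eta^-1).
have B10 : 0 < B + 1 by rewrite ltr_wpDl.
have eta0 : 0 < eta by rewrite !divr_gt0.
have eta1 : 0 < 1 + eta^-1 by rewrite addr_gt0 ?invr_gt0.
have delta0 : 0 < delta by rewrite !divr_gt0.
have [s s0 sY] := expR_norm_channel a.
have [p gp] := polynomials_dense P (Y a) s mY s0 sY g mg gY2 delta delta0.
exists p.
have m1 : measurable_fun setT (fun w => X w - g (Y a w)).
  by apply: measurable_funB => //; exact: (measurable_funPT X).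
have m2 : measurable_fun setT (fun w => g (Y a w) - p.[Y a w]).
  by apply: measurable_funB => //; exact: (measurableT_comp (measurable_horner _ p)).
have := integral_sqrD_le P _ _ eta eta0 m1 m2.
under eq_integral do rewrite subrKA.
move/le_trans; apply; rewrite -BE Beq.
apply: (@le_trans _ _ ((1 + eta)%:E * B%:E + (1 + eta^-1)%:E * delta%:E)%E).
  by apply: leeD => //; apply: lee_wpmul2l => //; rewrite lee_fin ltW.
rewrite -!EFinM -!EFinD lee_fin.
have -> : (1 + eta^-1) * delta = e / 2 by rewrite mulrC /delta divfK// gt_eqF.
have : eta * B <= e / 2.
  by rewrite /eta mulrAC ler_pdivrMr// ler_wpM2l ?divr_ge0 ?(ltW e0)// lerDl.
rewrite mulrDl mul1r; move: (eta * B) => x h; lra.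
Qed.

Local Notation pm n a := (pmmse P n X (fun w => a * X w + N w)).

Lemma pmmse_le (p : {poly R}) n (a : R) : (size p <= n.+1)%N -> (pm n a <= err p a)%E.
Proof.
by move=> pn; apply: ereal_inf_lbound; exists p => //; rewrite unlock.
Qed.

Lemma pmmse_antitone m n (a : R) : (m <= n)%N -> (pm n a <= pm m a)%E.
Proof.
move=> mn; apply: ereal_inf_le_tmp => _ [p /= pm <-]; exists p => //.
exact: leq_trans pm _.
Qed.

(** The estimator Y / a misses X by N / a. It has degree one, hence the index [n.+1]. *)
Lemma pmmse_scale n (a : R) : 0 < a ->
  (pm n.+1 a <= (a ^- 2)%:E * \int[P]_w ((N w) ^+ 2)%:E)%E.
Proof.
move=> a0; apply: (le_trans (pmmse_le (a^-1 *: 'X) n.+1 a _)).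
  by rewrite size_scale ?invr_eq0 ?gt_eqF// size_polyX.
rewrite -ge0_integralZl//.
- rewrite le_eqVlt; apply/orP; left; apply/eqP; apply: eq_integral => w _.
  rewrite -EFinM hornerZ hornerX; congr EFin; field; by rewrite gt_eqF.
- by apply/measurable_EFinP; apply: measurable_funX; exact: (measurable_funPT N).
- by rewrite lee_fin invr_ge0 sqr_ge0.
Qed.

Theorem pmmse_uniform (e : R) : 0 < e ->
  exists n0, forall n, (n0 <= n)%N -> forall a : R, 0 <= a ->
    (pm n a <= e%:E + bayes_risk P X a)%E.
Proof.
move=> e0; apply: contrapT => H.
have bayes0 (a : R) : (0 <= bayes_risk P X a)%E.
  by rewrite (bayes_riskE P X N XN NN sqr_integrableX) integral_ge0.
(* Since the error decreases with the degree, failure of the claim gives a bad parameter for every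
   degree. The index [n.+1] makes [pmmse_scale] applicable. *)
have /choice[z zP] : forall n, exists a : R,
    0 <= a /\ (e%:E + bayes_risk P X a < pm n.+1 a)%E.
  move=> n; apply: contrapT => Hn; apply: H; exists n.+1 => m nm a a0.
  rewrite leNgt; apply/negP => lt; apply: Hn; exists a; split => //.
  by apply: (lt_le_trans lt); exact: pmmse_antitone.
have [V VE] : exists V, (\int[P]_w ((N w) ^+ 2)%:E)%E = V%:E.
  have lty : (\int[P]_w ((N w) ^+ 2)%:E < +oo)%E.
    have := sqr_error_lty 'X 1; congr (_ < _)%E.
    apply: eq_integral => w _; rewrite hornerX; congr EFin; ring.
  exists (fine (\int[P]_w ((N w) ^+ 2)%:E)).
  by rewrite fineK// ge0_fin_numE// integral_ge0.
have V0 : 0 <= V by rewrite -lee_fin -VE integral_ge0.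
(* If z n > 1, then e <= V / (z n)^2 gives z n <= (z n)^2 <= V / e; otherwise z n <= 1 <= b. *)
pose b := V / e + 1.
have b1 : 1 <= b by rewrite lerDr divr_ge0// ltW.
have zb n : `|z n| <= b.
  have [z0 zn] := zP n; rewrite ger0_norm//.
  have [z1|z1] := leP (z n) 1; first exact: le_trans b1.
  have zn0 : 0 < z n by lra.
  have : (e%:E <= (z n ^- 2)%:E * V%:E)%E.
    rewrite -VE; apply: le_trans (pmmse_scale n _ zn0).
    by apply: le_trans (ltW zn); rewrite leeDl.
  rewrite -EFinM lee_fin mulrC ler_pdivlMr ?exprn_gt0// => h.
  have : z n ^+ 2 <= V / e by rewrite ler_pdivlMr// mulrC.
  rewrite /b; move: (V / e) => y; nra.
have bz : bounded_fun z.
  exists b; split; first exact: num_real.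
  by move=> x bx n _; apply: (le_trans (zb n)); exact: ltW.
have [f fincr /cvg_ex[a va]] := bolzano_weierstrass bz.
(* The extracted indices tend to infinity, so the degrees allowed along the subsequence eventually
   exceed that of a fixed polynomial. *)
have fn n : (n <= f n)%N.
  elim: n => // n IH; apply: (leq_ltn_trans IH).
  by rewrite ltnNge; apply/negP => h; have := fincr n.+1 n; rewrite leEnat h ltnn.
have [p pa] := polynomial_near_bayes a (e / 2) (divr_gt0 e0 (ltr0Sn _ 1)).
have Ev := cvg_sqr_error p (z \o f) a b b1 (fun n => zb (f n)) va.
have lsc := bayes_risk_lsc P X sqr_integrableX (z \o f) a va.
have Evc : (err p (z (f n)) - e%:E)%E @[n --> \oo] --> (err p a - e%:E)%E.
  by apply: cvgeB => //; [exact: fin_num_adde_defl|exact: cvg_cst].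
(* Once n reaches the size of p, p competes at [z (f n)], so the Bayes risk there is at most the
   error of p minus e. Passing to the limit contradicts [pa], which leaves a gap of only e / 2. *)
have : (bayes_risk P X a <= err p a - e%:E)%E.
  apply: (le_trans lsc); rewrite limn_einf_lim -(cvg_lim _ Evc)//.
  apply: lee_lim; first exact: is_cvg_einfs.
    by apply/cvg_ex; eexists; exact: Evc.
  near=> n.
  apply: (@le_trans _ _ (bayes_risk P X (z (f n)))).
    by apply: ereal_inf_lbound; exists n => /=.
  rewrite leeBrDr// addeC; have [_ /ltW zn] := zP (f n).
  apply: (le_trans zn); apply: pmmse_le.
  have pn : (size p <= n)%N by near: n; exact: nbhs_infty_ge.
  by rewrite (leq_trans pn)// (leq_trans (fn n))// -addn2 leq_addr.
have Blty := bayes_risk_lty P X N XN NN sqr_integrableX a.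
have [B Beq] : exists B, bayes_risk P X a = B%:E.
  by exists (fine (bayes_risk P X a)); rewrite fineK// ge0_fin_numE.
rewrite leeBrDr// => h; have := le_trans h pa.
by rewrite Beq -!EFinD lee_fin; lra.
Unshelve. all: by end_near. Qed.

End uniform_approximation.

(** * The channel at t = 0 *)

Section zero_snr.
Context {d} {T : measurableType d} {R : realType} (P : probability T R).
Variables (X N : {RV P >-> R}).
Hypothesis XN : independent_RV P X N.
Hypothesis NN : std_normal N.
Hypothesis iX2 : (\int[P]_w ((X w) ^+ 2)%:E < +oo)%E.

Lemma ge0_integral_indep_indic (u : R -> R) (B : set R) :
  measurable_fun setT u -> (forall x, 0 <= u x) -> measurable B ->
  (\int[P]_w (u (X w) * \1_(N @^-1` B) w)%:E =
   \int[P]_w (u (X w))%:E * P (N @^-1` B))%E.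
Proof.
move=> mu u0 mB.
rewrite (integral_independent P X N XN NN (fun z => (u z.1 * \1_B z.2)%:E)); first last.
- by move=> z; rewrite lee_fin mulr_ge0.
- apply/measurable_EFinP; apply: measurable_funM.
    apply: (measurableT_comp mu).
    exact: (@measurable_fst _ _ R (measurableTypeR R)).
  apply: measurableT_comp; first exact: measurable_indic.
  exact: (@measurable_snd _ _ R (measurableTypeR R)).
have NB : P (N @^-1` B) = normal_prob 0 1 B by rewrite -NN.
have inner x : (\int[normal_prob 0 1]_n (u x * \1_B n)%:E =
    (u x)%:E * P (N @^-1` B))%E.
  under eq_integral do rewrite EFinM.
  rewrite ge0_integralZl.
  - by rewrite integral_indic// setIT NB.
  - exact: measurableT.
  - apply/measurable_EFinP.
    exact: (@measurable_indic _ (measurableTypeR R)).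
  - by move=> y _; rewrite lee_fin.
  - by rewrite lee_fin.
under eq_integral do rewrite inner.
have mEu : measurable_fun setT (EFin \o u) by exact/measurable_EFinP.
rewrite ge0_integralZr//; last by move=> x _; rewrite lee_fin.
by rewrite (ge0_integral_distribution _ mEu).
Qed.

Local Lemma integrableX : P.-integrable setT (EFin \o X).
Proof.
have i2 : P.-integrable setT (fun w => ((X w) ^+ 2)%:E).
  apply/integrableP; split.
    by apply/measurable_EFinP; apply: measurable_funX; exact: measurable_funPT.
  by under eq_integral do rewrite gee0_abs//.
apply: (le_integrable measurableT _ _
  (integrableD measurableT (finite_measure_integrable_cst P 1 measurableT) i2)).
  by apply/measurable_EFinP; exact: measurable_funPT.
move=> w _; rewrite -EFinD lee_fin [leRHS]ger0_norm ?addr_ge0 ?sqr_ge0//.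
rewrite -[X in _ <= _ + X]real_normK ?num_real//.
have := sqr_ge0 (`|X w| - 1); have := normr_ge0 (X w).
by move: (`|X w|%R : R) => x x0 x1; rewrite /=; nra.
Qed.

(** The nonnegative case applied to the positive and negative parts of X; integrability of X makes
    the subtraction legitimate. *)
Local Lemma integral_indep_indic (m : R) (B : set R) : (\int[P]_w (X w)%:E)%E = m%:E ->
  measurable B ->
  (\int[P]_w (X w * \1_(N @^-1` B) w)%:E = m%:E * P (N @^-1` B))%E.
Proof.
move=> mE mB.
have mI : measurable (N @^-1` B) by exact: measurable_funPTI.
have XE w : X w = (@id R)^\+ (X w) - (@id R)^\- (X w).
  by rewrite -[LHS](congr1 (@^~ (X w)) (funrposBneg id)).
have mp : measurable_fun setT (@id R)^\+ by exact: measurable_funrpos.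
have mn : measurable_fun setT (@id R)^\- by exact: measurable_funrneg.
have ip (u : R -> R) : measurable_fun setT u -> (forall x, `|u x| <= `|x|) ->
    P.-integrable setT (fun w => (u (X w))%:E).
  move=> mu ux; apply: (le_integrable measurableT _ _ integrableX).
    by apply/measurable_EFinP; exact: measurableT_comp.
  by move=> w _; rewrite lee_fin.
have ipB (u : R -> R) : measurable_fun setT u -> (forall x, `|u x| <= `|x|) ->
    P.-integrable setT (fun w => (u (X w) * \1_(N @^-1` B) w)%:E).
  move=> mu ux; apply: (le_integrable measurableT _ _ integrableX).
    apply/measurable_EFinP; apply: measurable_funM; first exact: measurableT_comp.
    exact: measurable_indic.
  move=> w _; rewrite lee_fin normrM indicE; case: (_ \in _).
    by rewrite normr1 mulr1.
  by rewrite normr0 mulr0.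
have up x : `|(@id R)^\+ x| <= `|x|.
  by rewrite ger0_norm// /funrpos; case: (leP (id x) 0) => // _; exact: ler_norm.
have un x : `|(@id R)^\- x| <= `|x|.
  rewrite ger0_norm// /funrneg; case: (leP (- id x) 0) => // _.
  by rewrite -normrN; exact: ler_norm.
under eq_integral do rewrite XE mulrBl EFinB.
rewrite integralB//; [|exact: ipB|exact: ipB].
rewrite !ge0_integral_indep_indic//.
rewrite -mE; under [in RHS]eq_integral do rewrite XE EFinB.
rewrite integralB//; [|exact: ip|exact: ip].
have : P (N @^-1` B) \is a fin_num by exact: fin_num_measure.
have := integrable_fin_num measurableT (ip _ mp up).
have := integrable_fin_num measurableT (ip _ mn un).
move: (\int[P]_w _)%E (\int[P]_w _)%E (P (N @^-1` B)) => x y z xf yf zf.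
by rewrite muleBl// fin_num_adde_defl// fin_numN.
Qed.

(** At a = 0 the weight is the constant phi y, which cancels in A1 / A0. *)
Lemma posterior_mean0 (m y : R) : (\int[P]_w (X w)%:E)%E = m%:E ->
  posterior_mean P X 0 y = m.
Proof.
move=> mE; rewrite /posterior_mean /moment.
under eq_integral do rewrite expr1 mul0r subr0 EFinM.
under [in X in _ / X]eq_integral do rewrite expr0 mul1r mul0r subr0.
rewrite integralZr//; last exact: integrableX.
by rewrite mE integral_cst//= probability_setT mule1/= mulfK// gt_eqF//
  std_normal_pdf_gt0.
Qed.

(** By independence g and the constant m have the same integral over every Borel set under the law
    of N, so they agree almost everywhere for that law; the exceptional set is pulled back along
    N. *)
Lemma cond_exp_indep (g : R -> R) (m : R) : (\int[P]_w (X w)%:E)%E = m%:E ->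
  is_cond_exp P X N g ->
  (\int[P]_w ((X w - g (N w)) ^+ 2)%:E = \int[P]_w ((X w - m) ^+ 2)%:E)%E.
Proof.
move=> mE [mg ig gE].
have mEg : measurable_fun setT (EFin \o g) by exact/measurable_EFinP.
have igN : (distribution P N).-integrable setT (EFin \o g).
  exact: integrable_pushforward.
have [A [mA A0 AE]] : ae_eq (distribution P N) setT (EFin \o g) (cst m%:E).
  apply: integral_ae_eq => // B _ mB.
  have mI : measurable (N @^-1` B) by exact: measurable_funPTI.
  rewrite integral_cst// integral_pushforward//; last first.
    by apply: (integrableS measurableT).
  rewrite integral_mkcond; under eq_integral do rewrite epatch_indic/=.
  rewrite -(integral_indep_indic m B mE mB).
  by have := gE B mB; rewrite unlock => ->.
have mXc (h : T -> R) : measurable_fun setT h ->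
    measurable_fun setT (fun w => ((X w - h w) ^+ 2)%:E).
  by move=> mh; apply/measurable_EFinP; apply: measurable_funX; exact: measurable_funB.
apply: ge0_ae_eq_integral => //.
- by apply: mXc; exact: measurableT_comp.
- exact: (mXc (cst m)).
- exists (N @^-1` A); split => //.
    exact: measurable_funPTI.
  move=> w /= hw; apply: AE => /= gm; apply: hw => _.
  by have [->] := gm Logic.I.
Qed.

Lemma mmse_indep (g : R -> R) : is_cond_exp P X (Yt X N 0) g ->
  mmse P X (Yt X N 0) g = bayes_risk P X 0.
Proof.
have Y0 : Yt X N 0 = N.
  by apply/funext => w; rewrite /Yt sqrtr0 mul0r add0r.
rewrite Y0 => ceg.
have mE : (\int[P]_w (X w)%:E)%E = (fine (\int[P]_w (X w)%:E)%E)%:E.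
  by rewrite fineK// integrable_fin_num//; exact: integrableX.
rewrite /mmse unlock (cond_exp_indep _ _ mE ceg).
rewrite (bayes_riskE P X N XN NN iX2).
by apply: eq_integral => w _; rewrite (posterior_mean0 _ _ mE).
Qed.

End zero_snr.

(** * Bounds on the supremum from below and from above *)

Theorem theorem5p4 (d : measure_display) (T : measurableType d) (R : realType)
  (P : probability T R) (X N : {RV P >-> R}) (cexp : R -> R -> R) :
  independent_RV P X N ->
  std_normal N ->
  has_mgf P X ->
  (forall t : R, 0 <= t -> is_cond_exp P X (Yt X N t) (cexp t)) ->
  (fun n : nat => ereal_sup
     [set (pmmse P n X (Yt X N t) - mmse P X (Yt X N t) (cexp t))%E
      | t in [set t : R | 0 <= t]]) @ \oo --> 0%E.
Proof.
move=> XN NN mgfX ce.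
have iX2 := sqr_integrableX P X N NN mgfX.
set S := (X in X @ \oo --> _).
have S0 n : (0 <= S n)%E.
  (* At t = 0 the mmse equals the Bayes risk, which bounds every polynomial error from below. For
     general t only the inequality Bayes risk <= mmse is at hand, and it serves the upper bound. *)
  have key : (0 <= pmmse P n X (Yt X N 0%R) - mmse P X (Yt X N 0%R) (cexp 0%R))%E.
    rewrite (mmse_indep P X N XN NN iX2 _ (ce 0 (lexx 0))).
    have B0 : (0 <= bayes_risk P X 0%R)%E.
      by rewrite (bayes_riskE P X N XN NN iX2) integral_ge0.
    have Bfin : bayes_risk P X 0 \is a fin_num.
      by rewrite ge0_fin_numE//; exact: (bayes_risk_lty P X N XN NN iX2).
    rewrite suber_ge0//.
    apply: le_ereal_inf_tmp => _ [p _ <-]; rewrite unlock /Yt sqrtr0.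
    exact: (bayes_risk_le P X N XN NN iX2 (horner p) 0 (measurable_horner R p)).
  apply: (le_trans key); apply: ereal_sup_ubound.
  by exists 0 => //=.
have Se e : 0 < e -> \forall n \near \oo, (S n <= e%:E)%E.
  move=> e0; have [n0 n0P] := pmmse_uniform P X N XN NN mgfX e e0.
  near=> n; apply: ge_ereal_sup => _ [t /= t0 <-].
  have [mg _ _] := ce t t0.
  have : (pmmse P n X (Yt X N t) <= e%:E + mmse P X (Yt X N t) (cexp t))%E.
    apply: (@le_trans _ _ (e%:E + bayes_risk P X (Num.sqrt t))%E).
      by apply: n0P => //; near: n; exact: nbhs_infty_ge.
    rewrite leeD2lE// /mmse unlock.
    exact: (bayes_risk_le P X N XN NN iX2 _ _ mg).
  (* The mmse is handled as an extended real: in both infinite cases the difference evaluates to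
     -oo, by the convention that -oo absorbs +oo in a sum. *)
  case: (mmse P X (Yt X N t) (cexp t)) => [r| |].
  - by rewrite leeBlDr.
  - by move=> _; rewrite /= addeNy leNye.
  - by rewrite addeNy leeNy_eq => /eqP ->; rewrite addNye leNye.
apply/fine_cvgP; split.
  have S1 := Se 1 ltr01.
  by apply: filterS S1 => n S1; rewrite ge0_fin_numE// (le_lt_trans S1)// ltry.
apply/cvgrPdist_le => e e0; apply: filterS (Se e e0) => n Sne.
have Sfin : S n \is a fin_num by rewrite ge0_fin_numE// (le_lt_trans Sne)// ltry.
rewrite sub0r normrN ger0_norm ?fine_ge0//.
by rewrite -lee_fin fineK.
Unshelve. all: by end_near. Qed.
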